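(* Let $G$ be a loopless multigraph with $\operatorname{mad}(G)<3$. Then $G$ is $\frac15$-flexibly DP $3$-colorable, except precisely when $G$ has a subgraph isomorphic to a member of $\mathcal I=\{I_m : m\ge 1\}$. That is, $G$ is $\frac15$-flexibly DP $3$-colorable if and only if $G$ has no subgraph isomorphic to any $I_m$ with $m\ge1$.
   Context: Multigraphs are finite and nonempty; they may have multiple (parallel) edges but no loops. The maximum average degree $\operatorname{mad}(G)$ is the maximum of $2|E(G')|/|V(G')|$ over all (nonempty) subgraphs $G'$ of $G$, with edges counted with multiplicity. A $k$-cover $(H,L)$ of a multigraph $G$ is a graph $H$ together with pairwise disjoint vertex sets $L(v)$, $v\in V(G)$, whose union is $V(H)$, such that each $L(v)$ is a clique of size $k$ in $H$, and for each pair $\{x,y\}$ of distinct vertices of $G$ joined by exactly $s\ge 0$ edges in $G$, the set of edges of $H$ between $L(x)$ and $L(y)$ is the union of at most $s$ matchings between $L(x)$ and $L(y)$. Elements of $V(H)$ are called colors. An $(H,L)$-coloring of $G$ is a function $\varphi:V(G)\to V(H)$ with $\varphi(v)\in L(v)$ for every $v\in V(G)$ and $\varphi(x)\varphi(y)\notin E(H)$ for every edge $xy$ of $G$. A request on $G$ (with respect to $(H,L)$) is a function $r$ on some nonempty set $U\subseteq V(G)$ with $r(v)\in L(v)$ for each $v\in U$. $G$ is $\varepsilon$-flexibly DP $k$-colorable if for every $k$-cover $(H,L)$ of $G$ and every request $r$ (with domain $U$), there is an $(H,L)$-coloring $\varphi$ of $G$ such that $\varphi(v)=r(v)$ for at least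 $\varepsilon|U|$ vertices $v\in U$. For $m\ge1$, $I_m$ is the multigraph obtained from a $(2m+1)$-cycle $v_1v_2\ldots v_{2m+1}v_1$ by duplicating the edge $v_{2i-1}v_{2i}$ (so that it has multiplicity $2$) for each $i\in\{1,\dots,m\}$. *)

(* Defs.v *)
From mathcomp Require Import all_boot all_order all_algebra.

Set Implicit Arguments.
Unset Strict Implicit.
Unset Printing Implicit Defensive.

Import Order.TTheory GRing.Theory Num.Theory.

Local Open Scope ring_scope.

(* Edges form a type of their own, so parallel edges are distinct elements of
   [edge] with the same pair of ends; [ends_card] excludes loops. *)
Record multigraph := Multigraph {
  vertex :> finType;
  edge : finType;
  ends : edge -> {set vertex};
  vertex_nonempty : (0 < #|vertex|)%N;
  ends_card : forall e, #|ends e| = 2%N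
}.

Definition multiplicity (G : multigraph) (x y : G) : nat :=
  #|[set e : edge G | ends e == [set x; y]]|.

Definition is_subgraph (G : multigraph) (A : {set G}) (F : {set edge G}) : bool :=
  (A != set0) && [forall e in F, ends e \subset A].

(* The neutral value 0 does not affect the maximum: all ratios are nonnegative
   and [G], being nonempty, has at least one subgraph. *)
Definition mad (G : multigraph) : rat :=
  \big[Num.max/0]_(S : {set G} * {set edge G} | is_subgraph S.1 S.2)
    ((2 * #|S.2|)%:R / #|S.1|%:R).

Definition isomorphic_to_subgraph (K G : multigraph)
    (A : {set G}) (F : {set edge G}) : Prop :=
  exists (f : K -> G) (g : edge K -> edge G),
    [/\ injective f, injective g, f @: [set: K] = A, g @: [set: edge K] = F
      & forall e, ends (g e) = f @: ends e].

Definition has_subgraph_isomorphic_to (G K : multigraph) : Prop :=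
  exists (A : {set G}) (F : {set edge G}),
    is_subgraph A F /\ isomorphic_to_subgraph K A F.

Record sgraph := SGraph {
  svertex :> finType;
  adj : rel svertex;
  adj_sym : symmetric adj;
  adj_irrefl : irreflexive adj
}.

(* A matching between [X] and [Y], each edge being recorded as the pair of its
   end in [X] and its end in [Y]. *)
Definition matching_between (W : finType) (X Y : {set W})
    (M : {set W * W}) : Prop :=
  M \subset setX X Y /\
  forall p q, p \in M -> q \in M -> p.1 = q.1 \/ p.2 = q.2 -> p = q.

Definition edges_between (H : sgraph) (X Y : {set H}) : {set H * H} :=
  [set p in setX X Y | adj p.1 p.2].

(* [finset.cover Ms] is the union of the members of [Ms]. *)
Definition is_cover (k : nat) (G : multigraph) (H : sgraph)
    (L : G -> {set H}) : Prop :=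
  [/\ forall x y, x != y -> [disjoint L x & L y],
      \bigcup_v L v = [set: H],
      forall v, #|L v| = k,
      forall v, {in L v &, forall a b, a != b -> adj a b}
    & forall x y : G, x != y ->
        exists Ms : {set {set H * H}},
          [/\ (#|Ms| <= multiplicity x y)%N,
              forall M, M \in Ms -> matching_between (L x) (L y) M
            & edges_between (L x) (L y) = finset.cover Ms]].

Definition is_coloring (G : multigraph) (H : sgraph)
    (L : G -> {set H}) (phi : G -> H) : Prop :=
  (forall v, phi v \in L v) /\
  (forall (e : edge G) x y, ends e = [set x; y] -> ~~ adj (phi x) (phi y)).

(* A request is a domain [U] with a function [r] whose values outside [U] are
   irrelevant. *)
Definition is_request (G : multigraph) (H : sgraph)
    (L : G -> {set H}) (U : {set G}) (r : G -> H) : Prop :=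
  U != set0 /\ {in U, forall v, r v \in L v}.

Definition flexibly_DP_colorable (eps : rat) (k : nat) (G : multigraph) : Prop :=
  forall (H : sgraph) (L : G -> {set H}), is_cover k L ->
  forall (U : {set G}) (r : G -> H), is_request L U r ->
  exists phi : G -> H,
    is_coloring L phi /\
    eps * #|U|%:R <= #|[set v in U | phi v == r v]|%:R.

(* The multigraph I_m: the vertex v_{i+1} is [i : 'I_(m.*2.+1)]; [inl i] is the
   cycle edge from [i] to its cyclic successor [ordS i], and [inr j] is the
   additional copy of the edge v_{2j+1} v_{2j+2}. *)
Definition I_source (m : nat) (e : 'I_(m.*2.+1) + 'I_m) : 'I_(m.*2.+1) :=
  match e with inl i => i | inr j => inord j.*2 end.

Definition I_ends (m : nat) (e : 'I_(m.*2.+1) + 'I_m) : {set 'I_(m.*2.+1)} :=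
  [set I_source e; ordS (I_source e)].

Lemma I_vertex_nonempty (m : nat) : (0 < #|'I_(m.*2.+1)|)%N.
Proof. by rewrite card_ord. Qed.

Lemma I_ends_card (m : nat) (m_gt0 : (0 < m)%N) (e : 'I_(m.*2.+1) + 'I_m) :
  #|I_ends e| = 2%N.
Proof.
rewrite /I_ends cards2; case: eqP => // /(congr1 val) /=.
move: (I_source e) => i; have := ltn_ord i.
rewrite ltnS leq_eqVlt => /predU1P[->|lt_i].
  by rewrite modnn => /eqP; rewrite double_eq0 -leqn0 leqNgt m_gt0.
by rewrite modn_small // => /eqP; rewrite eqn_leq ltnn andbF.
Qed.

Definition I_multigraph (m : nat) (m_gt0 : (0 < m)%N) : multigraph :=
  Multigraph (I_vertex_nonempty m) (I_ends_card m_gt0).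

(* Main.v *)
(* By linear programming duality, having a distribution of colorings in which
   every vertex takes every color with probability at least [a] amounts to
   [flexible a A]: for every weight function [f] some coloring has total weight
   at least the sum over the vertices of the least value of [f v] under laws
   bounded below by [a]. This dual form needs no probability spaces.

   A reducible forest (few edges leave it, relative to its degrees) can be
   colored last, each vertex following a law that couples with the laws of its
   neighbors. A vertex set [C] of positive surplus [3 |C| - (number of ends of
   edges at C)] in a set without reducible forests has surplus exactly 1 and
   contains an almost reducible forest, which shows that an irreducible set is
   either split by a bridge, or has a vertex [w] of degree 2 whose removal
   leaves a set flexible with 1/4 in place of 1/5. The surplus 1/4 pays for [w],
   provided that some coloring of the rest leaves the best color of [w] free.
   If none does, then the two neighbors of [w] are joined by a path alternating
   between double and single edges, and together with [w] it is a copy of some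
   I_m. Conversely, a cover of I_m in which the double edges forbid all pairs of
   two colors, and the single edges one pair, determines the color of each vertex
   once that of v_{2m+1} is chosen, and so refuses the request for one color. *)
From Stdlib Require Import Classical_Prop.
Require Import Defs.
From mathcomp Require Import all_boot all_order all_fingroup all_algebra.
From mathcomp Require Import zify ring lra.

Set Implicit Arguments.
Unset Strict Implicit.
Unset Printing Implicit Defensive.

Import Order.TTheory GRing.Theory Num.Theory.

Local Open Scope ring_scope.

(** * Laws on three colors *)

(** The constants come from double edges. Two perfect matchings on three colors either avoid a third
    one or agree in exactly one pair; then the allowed pairs form a star, in which [t] goes with the
    colors other than [s], and [s] with the colors other than [t]. Across a star uniform laws do not
    couple: the probabilities of the two centers must add up to 1. With 1/2 at each center the other
    colors keep 1/4, so reducible forests support every bound up to 1/4. The value 1/5 is 4/5 of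
    1/4: colorings that are good away from [w] get weight 4/5, and the other 1/5 serves the best
    color of [w]. At a bridge the near end may take one color with probability up to 3/5, all colors
    having at least 1/5. The far side then needs a second coloring with another color at its end
    [p], which is affordable if no color of [p] has probability above 2/5. A star at [p] with 1/2 at
    its center violates this cap. It is repaired by the unequal centers 2/5 and 3/5, but only when
    the far side is just that double edge; a maximality argument reduces to this case. *)

Notation color := (option bool).

Definition sum3 (f : color -> rat) : rat := f None + f (Some false) + f (Some true).

Definition min3 (f : color -> rat) : rat :=
  Num.min (f None) (Num.min (f (Some false)) (f (Some true))).

(* The least value of [dot p f] over laws [p] bounded below by [a], where
   [3 a <= 1]. *)
Definition guarantee (a : rat) (f : color -> rat) : rat :=
  a * sum3 f + (1 - 3 * a) * min3 f.

Definition dot (p f : color -> rat) : rat := sum3 (fun c => p c * f c).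

Lemma sum3_distinct (f : color -> rat) (x y z : color) :
  x != y -> y != z -> x != z -> sum3 f = f x + f y + f z.
Proof. by move: x y z => [[]|] [[]|] [[]|] //= _ _ _; rewrite /sum3; ring. Qed.

Lemma color_cases (x y z : color) (c : color) :
  x != y -> y != z -> x != z -> [|| c == x, c == y | c == z].
Proof. by move: x y z c => [[]|] [[]|] [[]|] [[]|]. Qed.

Lemma sort3 (f : color -> rat) : exists x y z : color,
  [/\ x != y, y != z, x != z, f x <= f y & f y <= f z].
Proof.
have [h1|h1] := leP (f None) (f (Some false));
have [h2|h2] := leP (f None) (f (Some true));
have [h3|h3] := leP (f (Some false)) (f (Some true)).
- by exists None, (Some false), (Some true).
- by exists None, (Some true), (Some false); split => //; lra.
- by exists (Some true), None, (Some false); split => //; lra.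
- by exists (Some true), None, (Some false); split => //; lra.
- by exists (Some false), None, (Some true); split => //; lra.
- by exists None, (Some true), (Some false); split => //; lra.
- by exists (Some false), (Some true), None; split => //; lra.
- by exists (Some true), (Some false), None; split => //; lra.
Qed.

Lemma min3_sorted (f : color -> rat) (x y z : color) :
  x != y -> y != z -> x != z -> f x <= f y -> f y <= f z -> min3 f = f x.
Proof.
rewrite /min3; move: x y z => [[]|] [[]|] [[]|] //= _ _ _ h1 h2;
 case: (leP (f (Some false)) (f (Some true))) => ?;
  case: leP => ?; lra.
Qed.

Lemma min3_le (f : color -> rat) (c : color) : min3 f <= f c.
Proof. by rewrite /min3 !ge_min; move: c => [[]|]; rewrite lexx ?orbT. Qed.

(** A minimum of sums is at least the sum of the minima. This superadditivity allows weights sent by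
    several vertices to a common neighbor to be guaranteed one by one. *)
Lemma guarantee_split (a : rat) (f g h : color -> rat) : 3 * a <= 1 ->
  (forall c, h c = f c + g c) -> guarantee a f + guarantee a g <= guarantee a h.
Proof.
move=> a3 hE; rewrite /guarantee /sum3 !hE.
suff: (1 - 3 * a) * (min3 f + min3 g) <= (1 - 3 * a) * min3 h by lra.
apply: ler_wpM2l; first by lra.
rewrite {3}/min3 !hE !le_min !lerD ?min3_le //.
Qed.

Lemma guarantee_ext (a : rat) (f g : color -> rat) : f =1 g -> guarantee a f = guarantee a g.
Proof. by move=> fg; rewrite /guarantee /sum3 /min3 !fg. Qed.

Lemma half_lt1 : 1 / 2 < 1 :> rat. Proof. lra. Qed.

Lemma fifth3_le1 : 3 * (1 / 5) <= 1 :> rat. Proof. lra. Qed.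

Lemma guarantee_cst (a r : rat) : guarantee a (fun=> r) = r.
Proof. by rewrite /guarantee /sum3 /min3 !minxx; ring. Qed.

Lemma dot_sorted (p f : color -> rat) (x y z : color) :
  x != y -> y != z -> x != z -> dot p f = p x * f x + p y * f y + p z * f z.
Proof. exact: (sum3_distinct (fun c => p c * f c)). Qed.

(** The cap 1/2 is what makes any two laws couple across a single edge. *)
Definition law (p : color -> rat) : Prop :=
  [/\ forall c, 0 <= p c, sum3 p = 1 & forall c, p c <= 1/2].

Lemma dotD (p f g h : color -> rat) :
  (forall c, h c = f c + g c) -> dot p h = dot p f + dot p g.
Proof. by move=> hE; rewrite /dot /sum3 !hE; ring. Qed.

Lemma dot_le_max (p f : color -> rat) (al : pred color) :
  (forall c, 0 <= p c) -> sum3 p = 1 -> (forall c, ~~ al c -> p c = 0) ->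
  exists2 c, al c & dot p f <= f c.
Proof.
move=> p0 p1 psupp; have [x [y [z [xy yz xz fxy fyz]]]] := sort3 f.
rewrite (dot_sorted _ _ xy yz xz); move: p1; rewrite (sum3_distinct _ xy yz xz) => p1.
have [px py pz] := And3 (p0 x) (p0 y) (p0 z).
have [alz|/psupp pz0] := boolP (al z); first by exists z => //; nra.
have [aly|/psupp py0] := boolP (al y); first by exists y => //; nra.
have [alx|/psupp px0] := boolP (al x); first by exists x => //; nra.
lra.
Qed.

(* Every choice [h] of values at the second vertex can be answered by a map
   [kappa] from colors at the first vertex to compatible colors at the second
   one that does at least as well, on average, as the law [q]. *)
Definition coupling (R : color -> color -> bool) (al al' : pred color)
    (p q : color -> rat) : Prop :=
  forall h : color -> rat, exists2 kappa : color -> color,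
    forall c, al c -> R c (kappa c) && al' (kappa c)
    & dot q h <= dot p (h \o kappa).

(** The reply is the best color [hi] unless the edge bans it, and then the second best. The ban
    occurs with probability at most 1/2, and [q] itself gives [hi] at most 1/2, so the reply does at
    least as well as [q]. *)
Lemma coupling_matching (k : color -> color) (R : color -> color -> bool)
    (al al' : pred color) (p q : color -> rat) :
  injective k -> (forall c c', c' != k c -> R c c') -> law p -> law q ->
  (forall c, ~~ al' c -> q c = 0) -> coupling R al al' p q.
Proof.
move=> k_inj kR [p0 p1 p2] [q0 q1 q2] qsupp h.
have [hi [mid [hi_mid al_hi al_mid hle hdot]]] : exists hi mid : color,
    [/\ hi != mid, al' hi, al' mid, h mid <= h hi
      & dot q h <= q hi * h hi + (1 - q hi) * h mid].
  have [x [y [z [xy yz xz fxy fyz]]]] := sort3 h.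
  rewrite (dot_sorted _ _ xy yz xz); move: q1; rewrite (sum3_distinct _ xy yz xz) => q1.
  have [qx qy qz] := And3 (q0 x) (q0 y) (q0 z).
  have [qx' qy' qz'] := And3 (q2 x) (q2 y) (q2 z).
  have [alz|/qsupp qz0] := boolP (al' z).
    have [aly|/qsupp qy0] := boolP (al' y).
      by exists z, y; rewrite (eq_sym z y) yz; split=> //; nra.
    have [alx|/qsupp qx0] := boolP (al' x); last by lra.
    by exists z, x; rewrite (eq_sym z x) xz; split=> //; nra.
  have [aly|/qsupp qy0] := boolP (al' y); last by lra.
  have [alx|/qsupp qx0] := boolP (al' x); last by lra.
  by exists y, x; rewrite (eq_sym y x) xy; split=> //; nra.
exists (fun c => if k c == hi then mid else hi) => [c _|].
  case: eqP => [kc|/eqP kc]; rewrite ?al_hi ?al_mid andbT; apply: kR.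
    by rewrite kc eq_sym.
  by rewrite eq_sym.
apply: le_trans hdot _; move: (q2 hi) => qhi.
have [a b c] := And3 (p0 None) (p0 (Some false)) (p0 (Some true)).
have [a' b' c'] := And3 (p2 None) (p2 (Some false)) (p2 (Some true)).
move: p1; rewrite /dot /sum3 /=.
by case: eqP => [k1|_]; case: eqP => [k2|_]; case: eqP => [k3|_] p1;
  try (by have := k_inj _ _ (etrans k1 (esym k2)));
  try (by have := k_inj _ _ (etrans k1 (esym k3)));
  try (by have := k_inj _ _ (etrans k2 (esym k3))); nra.
Qed.

Definition uniform : color -> rat := fun=> 1 / 3.

Lemma sum3_comp (k : color -> color) (f : color -> rat) :
  injective k -> sum3 (f \o k) = sum3 f.
Proof.
move=> k_inj; have D c c' : c != c' -> k c != k c' by rewrite (inj_eq k_inj).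
have -> := @sum3_distinct f (k None) (k (Some false)) (k (Some true)).
all: by [|exact: D].
Qed.

Lemma coupling_perfect (k : color -> color) (R : color -> color -> bool)
    (al al' : pred color) :
  injective k -> (forall c, R c (k c)) -> (forall c, al' c) ->
  coupling R al al' uniform uniform.
Proof.
move=> k_inj kR al'T h; exists k => [c _|]; first by rewrite kR al'T.
have U (g : color -> rat) : dot uniform g = 1 / 3 * sum3 g.
  by rewrite /dot /uniform /sum3; ring.
by rewrite (U h) (U (h \o k)) (sum3_comp h k_inj) lexx.
Qed.

Lemma two_others (s : color) (h : color -> rat) : exists x y : color,
  [/\ s != x, x != y, s != y & h x <= h y].
Proof.
move: s => [[]|].
- by have [?|?] := leP (h None) (h (Some false));
    [exists None, (Some false) | exists (Some false), None; split=> //; lra].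
- by have [?|?] := leP (h None) (h (Some true));
    [exists None, (Some true) | exists (Some true), None; split=> //; lra].
- by have [?|?] := leP (h (Some true)) (h (Some false));
    [exists (Some true), (Some false) | exists (Some false), (Some true); split=> //; lra].
Qed.

Lemma third_color (x y : color) : x != y -> exists z : color, (x != z) && (y != z).
Proof.
by move: x y => [[]|] [[]|] // _; [exists None | exists (Some false) | exists None
  | exists (Some true) | exists (Some false) | exists (Some true)].
Qed.

Definition star_law (th : rat) (t : color) : color -> rat :=
  fun c => if c == t then th else (1 - th) / 2.

(** The complement of two perfect matchings that share exactly the pair of [t] and [s]: an allowed
    pair contains exactly one of the two centers. *)
Definition star (R : color -> color -> bool) (t s : color) : Prop :=
  forall c c', R c c' = (c == t) (+) (c' == s).

(** The center [t] is answered by the better color other than [s], every other color can only be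
    answered by [s]. So [s] is used with probability [1 - th], which forces [th + th' = 1]. *)
Lemma coupling_star (th th' : rat) (t s : color) (R : color -> color -> bool)
    (al al' : pred color) :
  0 <= th -> th + th' = 1 -> star R t s -> (forall c, al' c) ->
  coupling R al al' (star_law th t) (star_law th' s).
Proof.
move=> th0 th1 Rts al'T h.
have -> : th' = 1 - th by lra.
have [x [y [sx xy sy hxy]]] := two_others s h.
exists (fun c => if c == t then y else s) => [c _|].
  rewrite Rts al'T andbT; case: eqP => [_|_]; last by rewrite eqxx.
  by rewrite eq_sym (negPf sy).
rewrite (dot_sorted _ _ sx xy sy) /star_law eqxx !(eq_sym _ s) (negPf sx) (negPf sy).
by move: t {Rts} => [[]|]; rewrite /dot /sum3 /=; nra.
Qed.

Lemma law_uniform : law uniform.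
Proof. by split=> [c||c]; rewrite /uniform /sum3; lra. Qed.

Lemma law_star (t : color) : law (star_law (1 / 2) t).
Proof.
split=> [c||c]; rewrite /star_law; [case: ifP; lra | | case: ifP; lra].
by move: t => [[]|]; rewrite /sum3 /=; lra.
Qed.

Definition law_but (d : color) : color -> rat := fun c => if c == d then 0 else 1 / 2.

Lemma law_law_but (d : color) : law (law_but d).
Proof.
split=> [c||c]; rewrite /law_but; [case: ifP; lra | | case: ifP; lra].
by move: d => [[]|]; rewrite /sum3 /=; lra.
Qed.

Lemma dot_law_but (d : color) (f : color -> rat) :
  dot (law_but d) f = 1 / 2 * sum3 f - 1 / 2 * f d.
Proof. by move: d => [[]|]; rewrite /dot /law_but /sum3 /=; lra. Qed.

(** A vertex that has lost a color other than the center [t] still takes [t] with probability 1/2,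
    as the star requires. *)
Lemma coupling_but_star (c0 t s : color) (R : color -> color -> bool) (al al' : pred color) :
  t != c0 -> star R t s -> (forall c, al' c) ->
  coupling R al al' (law_but c0) (star_law (1 / 2) s).
Proof.
move=> tc st al'T h; have [x [y [sx xy sy hxy]]] := two_others s h.
have [d /andP[td cd]] := third_color tc.
exists (fun c => if c == t then y else s) => [c _|].
  rewrite st al'T andbT; case: eqP => [_|_]; last by rewrite eqxx.
  by rewrite eq_sym (negPf sy).
rewrite (dot_sorted _ _ sx xy sy) (dot_sorted _ _ tc cd td) /star_law /law_but /comp.
rewrite !eqxx !(eq_sym _ s) (negPf sx) (negPf sy) (eq_sym d c0) (eq_sym d t).
by rewrite (negPf tc) (negPf td) (negPf cd); lra.
Qed.

Lemma coupling_star_but (c0 t s : color) (R : color -> color -> bool) (al al' : pred color) :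
  t != c0 -> star R s t -> (forall c, c != c0 -> al' c) ->
  coupling R al al' (star_law (1 / 2) s) (law_but c0).
Proof.
move=> tc st al'T h; have [d /andP[td cd]] := third_color tc.
have [x [y [sx xy sy _]]] := two_others s h.
exists (fun c => if c == s then d else t) => [c _|].
  rewrite st; case: eqP => [_|_] /=; last by rewrite eqxx al'T.
  by rewrite eq_sym td al'T // eq_sym.
rewrite (dot_sorted _ _ tc cd td) (dot_sorted _ _ sx xy sy) /star_law /law_but /comp.
rewrite !eqxx !(eq_sym _ s) (negPf sx) (negPf sy) (eq_sym d c0).
by rewrite (negPf tc) (negPf cd); lra.
Qed.

Lemma coupling_perfect_but (c0 : color) (k : color -> color) (R : color -> color -> bool)
    (al al' : pred color) :
  injective k -> (forall c, R c (k c)) -> (forall c, al c -> c != c0) ->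
  (forall c, c != k c0 -> al' c) ->
  coupling R al al' (law_but c0) (law_but (k c0)).
Proof.
move=> k_inj kR alc al'T h; exists k => [c /alc cc0|].
  by rewrite kR al'T // (inj_eq k_inj).
by rewrite !dot_law_but (sum3_comp h k_inj) lexx.
Qed.

Lemma guarantee_le_dot (a : rat) (p f : color -> rat) :
  sum3 p = 1 -> (forall c, a <= p c) -> guarantee a f <= dot p f.
Proof.
move=> p1 pa; have [x [y [z [xy yz xz fxy fyz]]]] := sort3 f.
rewrite /guarantee (dot_sorted _ _ xy yz xz) (sum3_distinct f xy yz xz).
rewrite (min3_sorted xy yz xz fxy fyz); move: p1; rewrite (sum3_distinct p xy yz xz).
by move: (pa x) (pa y) (pa z); nra.
Qed.

Lemma sum3_star_law (th : rat) (t : color) : sum3 (star_law th t) = 1.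
Proof. by rewrite /star_law /sum3; move: t => [[]|] /=; lra. Qed.

Lemma guarantee_uniform (a : rat) (f : color -> rat) :
  a <= 1 / 4 -> guarantee a f <= dot uniform f.
Proof.
move=> a4; apply: guarantee_le_dot => [|c]; last by rewrite /uniform; lra.
by have [] := law_uniform.
Qed.

Lemma guarantee_star (a th : rat) (t : color) (f : color -> rat) :
  a <= th -> 2 * a + th <= 1 -> guarantee a f <= dot (star_law th t) f.
Proof.
move=> ath ath'; apply: guarantee_le_dot => [|c]; first exact: sum3_star_law.
by rewrite /star_law; case: ifP; lra.
Qed.

(* The color [k c] is lost at a vertex whose outside neighbor has color [c]. *)
Lemma guarantee_lost (a : rat) (k : color -> color) (f : color -> rat) :
  0 <= a -> 3 * a <= 1 -> injective k ->
  guarantee a f <= guarantee a (fun c => dot (law_but (k c)) f).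
Proof.
move=> a0 a3 k_inj.
have [x [y [z [xy yz xz fxy fyz]]]] := sort3 f.
set g := fun c => _.
have Sg : sum3 g = sum3 f.
  have -> : sum3 g = sum3 (fun c => 1/2 * sum3 f - 1/2 * (f \o k) c).
    by rewrite /g /sum3 !dot_law_but.
  have -> : sum3 (fun c => 1/2 * sum3 f - 1/2 * (f \o k) c)
     = 3/2 * sum3 f - 1/2 * sum3 (f \o k) by rewrite /sum3; lra.
  by rewrite (sum3_comp f k_inj); lra.
have Mg : 1/2 * (f x + f y) <= min3 g.
  rewrite /min3 !le_min /g !dot_law_but (sum3_distinct f xy yz xz).
  have fz c : f c <= f z.
    by have /or3P[/eqP->|/eqP->|/eqP->] := color_cases c xy yz xz; lra.
  by have [h1 h2 h3] := And3 (fz (k None)) (fz (k (Some false))) (fz (k (Some true)));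
    apply/and3P; split; lra.
rewrite /guarantee Sg (min3_sorted xy yz xz fxy fyz); nra.
Qed.

(** Two permutations of three colors differ by the identity, a 3-cycle or a transposition. The first
    two leave a perfect matching free, the last one a star centered at the pair they share. *)
Lemma two_matchings (k1 k2 : color -> color) : injective k1 -> injective k2 ->
  (exists2 k : color -> color, injective k & forall c, (k c != k1 c) && (k c != k2 c)) \/
  (exists t s, star (fun c c' => (c' != k1 c) && (c' != k2 c)) t s).
Proof.
move=> k1_inj k2_inj.
have D1 c c' : c != c' -> k1 c != k1 c' by rewrite (inj_eq k1_inj).
have D2 c c' : c != c' -> k2 c != k2 c' by rewrite (inj_eq k2_inj).
pose mk (a b c d : color) := match d with None => a | Some false => b | Some true => c end.
have mkP a b c : a != b -> b != c -> a != c ->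
  (a != k1 None) && (a != k2 None) -> (b != k1 (Some false)) && (b != k2 (Some false)) ->
  (c != k1 (Some true)) && (c != k2 (Some true)) ->
  exists2 k : color -> color, injective k & forall c, (k c != k1 c) && (k c != k2 c).
  move=> ab bc ac h1 h2 h3; exists (mk a b c); last by move=> [[]|].
  move=> x y; move: a b c {h1 h2 h3} ab bc ac.
  by case=> [[]|]; case=> [[]|]; case=> [[]|] //= _ _ _; move: x y => [[]|] [[]|].
have stP t s :
  (forall c', (c' != k1 None) && (c' != k2 None) = (None == t) (+) (c' == s)) ->
  (forall c', (c' != k1 (Some false)) && (c' != k2 (Some false))
     = (Some false == t) (+) (c' == s)) ->
  (forall c', (c' != k1 (Some true)) && (c' != k2 (Some true))
     = (Some true == t) (+) (c' == s)) ->
  exists t s, star (fun c c' => (c' != k1 c) && (c' != k2 c)) t s.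
  by move=> h1 h2 h3; exists t, s; move=> [[]|].
move: (D1 None (Some false) isT) (D1 None (Some true) isT) (D1 (Some false) (Some true) isT).
move: (D2 None (Some false) isT) (D2 None (Some true) isT) (D2 (Some false) (Some true) isT).
move: mkP stP => mkP stP d1 d2 d3 d4 d5 d6; move: d4 d5 d6 d1 d2 d3 mkP stP.
(* Injectivity leaves six possibilities for each map; in each of the 36 cases an explicit
   permutation or an explicit pair of centers works. *)
case: (k1 None) => [[]|]; case: (k1 (Some false)) => [[]|] //= _;
case: (k1 (Some true)) => [[]|] //= _ _;
case: (k2 None) => [[]|]; case: (k2 (Some false)) => [[]|] //= _;
case: (k2 (Some true)) => [[]|] //= _ _ mkP stP;
solve [left; first [exact: (mkP None (Some false) (Some true))
 | exact: (mkP None (Some true) (Some false)) | exact: (mkP (Some false) None (Some true))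
 | exact: (mkP (Some false) (Some true) None) | exact: (mkP (Some true) None (Some false))
 | exact: (mkP (Some true) (Some false) None)]
 | right; first [apply: (stP None None); case=> [[]|]; done
 | apply: (stP None (Some false)); case=> [[]|]; done
 | apply: (stP None (Some true)); case=> [[]|]; done
 | apply: (stP (Some false) None); case=> [[]|]; done
 | apply: (stP (Some false) (Some false)); case=> [[]|]; done
 | apply: (stP (Some false) (Some true)); case=> [[]|]; done
 | apply: (stP (Some true) None); case=> [[]|]; done
 | apply: (stP (Some true) (Some false)); case=> [[]|]; done
 | apply: (stP (Some true) (Some true)); case=> [[]|]; done ]].
Qed.

(** * Reducible forests *)

(* A cover with three colors at every node, presented by the pairs of colors
   that are banned: an edge of multiplicity [mult x y] bans the union of that
   many perfect matchings. *)
Record network := Network {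
  node :> finType;
  mult : node -> node -> nat;
  ban : node -> node -> color -> color -> bool;
  mult_sym : forall x y, mult x y = mult y x;
  mult_irrefl : forall x, mult x x = 0%N;
  ban_sym : forall x y c c', ban x y c c' = ban y x c' c;
  ban_matchings : forall x y, exists2 ks : seq {perm color},
    size ks = mult x y &
    forall c c', ban x y c c' = has (fun k : {perm color} => k c == c') ks
}.

Section Network.

Variable V : network.
Implicit Types (x y u v o b : V).

Definition nbr (x y : V) : bool := (0 < mult x y)%N.

Lemma nbr_sym x y : nbr x y = nbr y x.
Proof. by rewrite /nbr mult_sym. Qed.

Lemma ban_nbr x y c c' : ~~ nbr x y -> ban x y c c' = false.
Proof.
rewrite /nbr -eqn0Ngt => /eqP m0; have [ks] := ban_matchings x y.
by rewrite m0 => /size0nil -> ->.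
Qed.

Lemma ban_single x y : mult x y = 1%N -> exists2 k : color -> color,
  injective k & forall c c', ban x y c c' = (c' == k c).
Proof.
have [ks size_ks banE] := ban_matchings x y; rewrite -size_ks.
case: ks {size_ks} banE => [|k [|]] //= banE _; exists k; first exact: perm_inj.
by move=> c c'; rewrite banE orbF eq_sym.
Qed.

Definition okc (x y : V) (c c' : color) : bool := ~~ ban x y c c'.

Lemma okc_sym x y c c' : okc x y c c' = okc y x c' c.
Proof. by rewrite /okc ban_sym. Qed.

Lemma okc_single x y : mult x y = 1%N -> exists2 k : color -> color,
  injective k & forall c c', okc x y c c' = (c' != k c).
Proof. by case/ban_single => k k_inj kE; exists k => // c c'; rewrite /okc kE. Qed.

Definition perfect (x y : V) : Prop :=
  exists2 k : color -> color, injective k & forall c, okc x y c (k c).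

Lemma double_perfect_or_star x y : mult x y = 2%N ->
  perfect x y \/ exists t s, star (okc x y) t s.
Proof.
have [ks size_ks banE] := ban_matchings x y; rewrite -size_ks.
case: ks {size_ks} banE => [|k1 [|k2 []]] //= banE _.
have okE c c' : okc x y c c' = (c' != k1 c) && (c' != k2 c).
  by rewrite /okc banE orbF negb_or !(eq_sym _ c').
have [[k k_inj kE]|[t [s ts]]] := two_matchings (@perm_inj _ k1) (@perm_inj _ k2).
  by left; exists k => // c; rewrite okE kE.
by right; exists t, s => c c'; rewrite okE ts.
Qed.

Lemma star_sym x y t s : star (okc x y) t s -> star (okc y x) s t.
Proof. by move=> ts c c'; rewrite okc_sym ts addbC. Qed.

Lemma star_inj x y t s t' s' :
  star (okc x y) t s -> star (okc x y) t' s' -> t = t' /\ s = s'.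
Proof.
move=> ts ts'; have E c c' : (c == t) (+) (c' == s) = (c == t') (+) (c' == s').
  by rewrite -ts -ts'.
by move: t s t' s' E {ts ts'} => [[]|] [[]|] [[]|] [[]|] E //;
  move: (E None None) (E None (Some true)) (E None (Some false))
    (E (Some true) None) (E (Some true) (Some true)) (E (Some true) (Some false))
    (E (Some false) None) (E (Some false) (Some true)) (E (Some false) (Some false)).
Qed.

Lemma star_perfectN x y t s : star (okc x y) t s -> perfect x y -> False.
Proof.
move=> ts [k k_inj kE]; have D c c' : c != c' -> k c != k c' by rewrite (inj_eq k_inj).
have E c : (c == t) (+) (k c == s) by rewrite -ts kE.
move: (E None) (E (Some false)) (E (Some true)) (D None (Some false) isT)
  (D None (Some true) isT) (D (Some false) (Some true) isT).
move: t s {ts E}.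
by case: (k None) => [[]|]; case: (k (Some false)) => [[]|];
  case: (k (Some true)) => [[]|] [[]|] [[]|].
Qed.

(* Colorings are total functions; only their values on the set under
   consideration matter. *)
Definition legal (A : {set V}) (phi : V -> color) : Prop :=
  {in A &, forall x y, okc x y (phi x) (phi y)}.

Definition flexible (a : rat) (A : {set V}) : Prop :=
  forall f : V -> color -> rat, exists2 phi, legal A phi &
    \sum_(v in A) guarantee a (f v) <= \sum_(v in A) f v (phi v).

Definition upd (phi : V -> color) (v : V) (c : color) : V -> color :=
  fun x => if x == v then c else phi x.

(** The list is an elimination order: each vertex has at most one neighbor later in the list, its
    parent. *)
Fixpoint forest (s : seq V) : bool :=
  if s is v :: s' then (count (nbr v) s' <= 1)%N && forest s' else true.

Lemma count1_witness (P : pred V) (s : seq V) : uniq s -> count P s = 1%N ->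
  exists2 u, u \in s & forall y, y \in s -> P y = (y == u).
Proof.
elim: s => //= v s IH /andP[vs us]; case: (boolP (P v)) => [Pv|Pv] /=; last first.
  rewrite add0n => /(IH us)[u us' uP]; exists u; first by rewrite inE us' orbT.
  move=> y; rewrite inE => /predU1P[->|/uP//]; rewrite (negPf Pv).
  by apply/esym/eqP => vu; rewrite vu us' in vs.
rewrite add1n => /eqP; rewrite eqSS => /eqP c0; exists v; first by rewrite mem_head.
move=> y; rewrite inE => /predU1P[->|ys]; first by rewrite eqxx Pv.
have /eqP := c0; rewrite -leqn0 leqNgt -has_count => /hasPn/(_ y ys)/negPf->.
by apply/esym/eqP => yv; rewrite -yv ys in vs.
Qed.

(** The head is colored after its only neighbor [u] in the tail. Its reply [kap] to each color of
    [u] is charged to [u] as extra weight, so that the tail is chosen with the head in view; the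
    coupling bounds this extra weight from below. *)
Lemma forest_coloring (s : seq V) (al : V -> pred color) (p : V -> color -> rat) :
  uniq s -> forest s ->
  {in s, forall v, [/\ forall c, 0 <= p v c, sum3 (p v) = 1
                     & forall c, ~~ al v c -> p v c = 0]} ->
  {in s &, forall u v, nbr u v -> coupling (okc u v) (al u) (al v) (p u) (p v)} ->
  forall f : V -> color -> rat, exists phi : V -> color,
    [/\ {in s, forall v, al v (phi v)}, {in s &, forall x y, okc x y (phi x) (phi y)}
      & \sum_(v <- s) dot (p v) (f v) <= \sum_(v <- s) f v (phi v)].
Proof.
elim: s => [|v s IH] /=; first by exists (fun=> None); split=> //; rewrite !big_nil.
move=> /andP[vs us] /andP[cs fs] ps cp f.
have ps' : {in s, forall v, [/\ forall c, 0 <= p v c, sum3 (p v) = 1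
                     & forall c, ~~ al v c -> p v c = 0]}.
  by move=> u us'; apply: ps; rewrite inE us' orbT.
have cp' : {in s &, forall u v, nbr u v -> coupling (okc u v) (al u) (al v) (p u) (p v)}.
  by move=> u w us' ws; apply: cp; rewrite inE ?us' ?ws orbT.
have okvv c c' : okc v v c c' by rewrite /okc ban_nbr // /nbr mult_irrefl.
have updE phi c y : y \in s -> upd phi v c y = phi y.
  by rewrite /upd; case: eqP => // ->; rewrite (negPf vs).
have updv phi c : upd phi v c v = c by rewrite /upd eqxx.
have fin phi c : al v c -> {in s, forall v, al v (phi v)} ->
    {in s &, forall x y, okc x y (phi x) (phi y)} ->
    {in s, forall y, okc v y c (phi y)} ->
    {in v :: s, forall x, al x (upd phi v c x)} /\
    {in v :: s &, forall x y, okc x y (upd phi v c x) (upd phi v c y)}.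
  move=> alc als oks okv; split=> [x|x y].
    by rewrite inE => /predU1P[->|xs]; rewrite ?updv ?updE //; apply: als.
  rewrite !inE => /predU1P[->|xs] /predU1P[->|ys]; rewrite ?updv ?updE //.
  - exact: okv.
  - by rewrite okc_sym; apply: okv.
  - exact: oks.
have [p0 p1 p2] := ps v (mem_head _ _).
have [c0|c1] : count (nbr v) s = 0%N \/ count (nbr v) s = 1%N.
- by case: (count _ _) cs => [|[]]; [left|right|].
- have [phi [als oks hs]] := IH us fs ps' cp' f.
  have [c alc hc] := dot_le_max (f v) p0 p1 p2.
  exists (upd phi v c); have [|h1 h2] := fin phi c alc als oks.
    move=> y ys; rewrite /okc ban_nbr //.
    by have /eqP := c0; rewrite -leqn0 leqNgt -has_count => /hasPn/(_ y ys).
  split=> //; rewrite !big_cons updv lerD //.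
  by rewrite [leRHS](eq_big_seq (fun y => f y (phi y))) // => y ys; rewrite updE.
have [u us' uP] := count1_witness us c1.
have nuv : nbr u v by rewrite nbr_sym uP.
have vsv : v \in v :: s by rewrite mem_head.
have usv : u \in v :: s by rewrite inE us' orbT.
have [kap kapP kapD] := cp u v usv vsv nuv (f v).
have [phi [als oks hs]] := IH us fs ps' cp'
  (fun y c => f y c + (if y == u then f v (kap c) else 0)).
exists (upd phi v (kap (phi u))).
have /andP[okk alk] := kapP (phi u) (als u us').
have [|h1 h2] := fin phi (kap (phi u)) alk als oks.
  move=> y ys; have [->|yu] := eqVneq y u; first by rewrite okc_sym.
  by rewrite /okc ban_nbr // uP.
split=> //; rewrite !big_cons updv.
rewrite [X in _ <= _ + X](eq_big_seq (fun y => f y (phi y))); last by move=> y ys; rewrite updE.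
have single (r : V -> rat) : \sum_(y <- s) (if y == u then r y else 0) = r u.
  rewrite (bigD1_seq u us' us) /= eqxx big1 ?addr0 // => y /negPf -> //.
have dE y : dot (p y) (fun c => f y c + (if y == u then f v (kap c) else 0)) =
    dot (p y) (f y) + (if y == u then dot (p u) (f v \o kap) else 0).
  rewrite (@dotD _ (f y) (fun c => if y == u then f v (kap c) else 0)) //.
  by case: eqP => [->//|_]; rewrite /dot /sum3; ring.
rewrite (eq_bigr _ (fun y _ => dE y)) in hs.
rewrite [leLHS]big_split [leRHS]big_split /= !single in hs.
apply: le_trans (lerD kapD (lexx _)) _; rewrite addrC; apply: le_trans hs _.
by rewrite addrC.
Qed.

Definition dg (A : {set V}) (v : V) : nat := \sum_(y in A) mult v y.

Definition nb (s : seq V) (v : V) : nat := count (nbr v) s.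

(* [s] induces a forest of the underlying simple graph, and every vertex of [s]
   has at most one edge, inside [A], beyond one edge to each of its neighbors
   in [s]: either an edge leaving [s] or a second parallel edge. *)
Definition reducible (A : {set V}) (s : seq V) : Prop :=
  [/\ s != [::], uniq s, forest s
    & {in s, forall v, v \in A /\ (dg A v <= (nb s v).+1)%N}].

Lemma sum_le1_cases (A : {set V}) (F : V -> nat) : (\sum_(y in A) F y <= 1)%N ->
  {in A, forall y, F y = 0%N} \/
  exists2 o, o \in A & F o = 1%N /\ {in A, forall y, y != o -> F y = 0%N}.
Proof.
move=> le1; have [/existsP[o /andP[oA Fo]]|] := boolP [exists o, (o \in A) && (0 < F o)%N].
  right; exists o => //; move: le1; rewrite (bigD1 o) //= => le1.
  have F1 : F o = 1%N by lia.
  split=> // y yA yo; move: le1; rewrite F1 (bigD1 y) ?yA //=; lia.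
rewrite negb_exists => /forallP F0; left=> y yA.
by move: (F0 y); rewrite yA /= -eqn0Ngt => /eqP.
Qed.

(** [F] counts the edges at [v] beyond the first one to each neighbor in [s], so its sum over [A] is
    [dg A v - nb s v], hence at most 1. *)
Lemma excess_cases (A : {set V}) (s : seq V) (v : V) :
  uniq s -> {subset s <= A} -> (dg A v <= (nb s v).+1)%N ->
  let F y := if y \in s then (mult v y).-1 else mult v y in
  {in A, forall y, F y = 0%N} \/
  exists2 o, o \in A & F o = 1%N /\ {in A, forall y, y != o -> F y = 0%N}.
Proof.
move=> us sA hd F; apply: sum_le1_cases.
suff: dg A v = (\sum_(y in A) F y + nb s v)%N by lia.
have -> : nb s v = \sum_(y in A) (if y \in s then nbr v y : nat else 0%N).
  rewrite /nb -sum1_count big_mkcond big_uniq // [LHS]big_mkcond [RHS]big_mkcond /=.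
  apply: eq_bigr => y _; case: (boolP (y \in s)) => [ys|_]; last by case: ifP.
  by rewrite sA //; case: (nbr v y).
rewrite -big_split /=; apply: eq_bigr => y yA; rewrite /F /nbr.
by case: ifP => _; case: (mult v y) => [|k] /=; rewrite ?addn0 ?addn1.
Qed.

(* The edge that a vertex of a reducible forest may have in excess: one leaving
   the forest, by which a color is lost, a second parallel edge, whose allowed
   pairs form a star or contain a perfect matching, or none. *)
Inductive vkind :=
  | Lost of V & (color -> color)
  | Star of V & color & color
  | Perf of V & (color -> color)
  | Unif.

Definition kind_ok (A : {set V}) (s : seq V) (v : V) (k : vkind) : Prop :=
  match k with
  | Lost o k => [/\ o \in A, o \notin s, injective k, forall c c', ban o v c c' = (c' == k c)
      & {in A, forall y, y \notin s -> y != o -> mult v y = 0%N}] /\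
      {in s, forall y, (mult v y <= 1)%N}
  | Star b t t' => [/\ b \in s, mult v b = 2%N, star (okc v b) t t',
      {in A, forall y, y \notin s -> mult v y = 0%N}
      & {in s, forall y, y != b -> (mult v y <= 1)%N}]
  | Perf b k => [/\ b \in s, mult v b = 2%N, injective k /\ forall c, okc v b c (k c),
      {in A, forall y, y \notin s -> mult v y = 0%N}
      & {in s, forall y, y != b -> (mult v y <= 1)%N}]
  | Unif => {in A, forall y, y \notin s -> mult v y = 0%N} /\
      {in s, forall y, (mult v y <= 1)%N}
  end.

Definition kind_al (psi : V -> color) (k : vkind) : pred color :=
  match k with Lost o k => [pred c | c != k (psi o)] | _ => xpredT end.

Definition kind_law (psi : V -> color) (k : vkind) : color -> rat :=
  match k with
  | Lost o k => law_but (k (psi o))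
  | Star _ t _ => star_law (1 / 2) t
  | _ => uniform
  end.

Lemma reducible_kinds (A : {set V}) (s : seq V) : reducible A s ->
  exists K : V -> vkind, {in s, forall v, kind_ok A s v (K v)}.
Proof.
case=> _ us _ hs; have sA : {subset s <= A} by move=> v /hs[].
suff: forall v, exists k, v \in s -> kind_ok A s v k.
  by case/fin_all_exists => K hK; exists K => v vs; apply: hK.
move=> v; have [vs|_] := boolP (v \in s); last by exists Unif.
have [vA hd] := hs v vs.
have le1 y : (if y \in s then (mult v y).-1 else mult v y) = 0%N ->
    y \in s -> (mult v y <= 1)%N by move=> E ys; move: E; rewrite ys; case: (mult v y) => [|[]].
have [F0|[o oA [Fo F0]]] := excess_cases us sA hd.
  exists Unif => _; split=> [y yA ys|y ys]; first by have := F0 y yA; rewrite (negPf ys).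
  by apply: le1 (F0 y (sA y ys)) ys.
have F1 y : y \in A -> y \notin s -> y != o -> mult v y = 0%N.
  by move=> yA ys yo; have := F0 y yA yo; rewrite (negPf ys).
move: Fo; case: ifPn => [os|os] Fo.
  have m2 : mult v o = 2%N by lia.
  have F1' : {in A, forall y, y \notin s -> mult v y = 0%N}.
    by move=> y yA ys; apply: F1 => //; apply: contraNneq ys => ->.
  have F2 y : y \in s -> y != o -> (mult v y <= 1)%N.
    by move=> ys yo; apply: le1 (F0 y (sA y ys) yo) ys.
  have [[k k_inj kE]|[t [t' ts]]] := double_perfect_or_star m2; last by exists (Star o t t').
  by exists (Perf o k).
have [k k_inj kE] := ban_single (etrans (mult_sym o v) Fo).
exists (Lost o k) => _; split; [by split | move=> y ys].
apply: (le1 y (F0 y (sA y ys) _) ys).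
by apply/eqP => yo; rewrite -yo ys in os.
Qed.

Lemma kind_law_law (psi : V -> color) (k : vkind) :
  law (kind_law psi k) /\ forall c, ~~ kind_al psi k c -> kind_law psi k c = 0.
Proof.
case: k => [o k|b t t'|b k|] /=.
- split; first exact: law_law_but.
  by move=> c /negPn/eqP->; rewrite /law_but eqxx.
- by split; first exact: law_star.
- by split; first exact: law_uniform.
- by split; first exact: law_uniform.
Qed.

(** A single edge couples any two laws. A double edge is the one excess edge of both its ends, so
    each end names the other as partner, and the two ends are of the same kind, with centers that
    agree. *)
Lemma kind_coupling (A : {set V}) (s : seq V) (psi : V -> color) (u v : V) (ku kv : vkind) :
  u \in s -> v \in s -> nbr u v -> kind_ok A s u ku -> kind_ok A s v kv ->
  coupling (okc u v) (kind_al psi ku) (kind_al psi kv) (kind_law psi ku) (kind_law psi kv).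
Proof.
move=> us vs nuv hu hv.
have [muv|muv] : mult u v = 1%N \/ (1 < mult u v)%N by move: nuv; rewrite /nbr; lia.
  have [k k_inj kE] := okc_single muv.
  have [[lu su] [lv sv]] := (kind_law_law psi ku, kind_law_law psi kv).
  by apply: coupling_matching k_inj _ lu lv sv => c c'; rewrite kE.
have mvu : (1 < mult v u)%N by rewrite mult_sym.
have eq_partner x y b : (1 < mult x y)%N -> y \in s ->
    {in s, forall z, z != b -> (mult x z <= 1)%N} -> y = b.
  by move=> mxy ys h; case: (eqVneq y b) => // /(h y ys); rewrite leqNgt => /negP.
have noL x y : (1 < mult x y)%N -> (mult x y <= 1)%N -> False.
  by move=> h1 h2; have := leq_trans h1 h2; rewrite ltnn.
case: ku hu => [o k [_ /(_ v vs)/(noL _ _ muv)[]]|b t t' [_ _ ts _ hb]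
    |b k [_ _ [k_inj kE] _ hb]|[_ /(_ v vs)/(noL _ _ muv)[]]].
  have bv := eq_partner u v b muv vs hb; rewrite -bv in ts.
  case: kv hv => [o k [_ /(_ u us)/(noL _ _ mvu)[]]|b' r r' [_ _ rs _ hb']
      |b' k [_ _ [k_inj kE] _ hb']|[_ /(_ u us)/(noL _ _ mvu)[]]].
    have bu := eq_partner v u b' mvu us hb'; rewrite -bu in rs.
    have [-> _] := star_inj rs (star_sym ts).
    by apply: coupling_star ts _; [clear; lra | clear; lra |].
  have bu := eq_partner v u b' mvu us hb'; rewrite -bu in kE.
  by case: (star_perfectN (star_sym ts)); exists k.
have bv := eq_partner u v b muv vs hb; rewrite -bv in kE.
case: kv hv => [o k' [_ /(_ u us)/(noL _ _ mvu)[]]|b' r r' [_ _ rs _ hb']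
    |b' k' _|[_ /(_ u us)/(noL _ _ mvu)[]]].
  have bu := eq_partner v u b' mvu us hb'; rewrite -bu in rs.
  by case: (star_perfectN (star_sym rs)); exists k.
by apply: coupling_perfect k_inj kE _.
Qed.

Lemma reducible_coloring (A : {set V}) (s : seq V) (K : V -> vkind)
    (psi : V -> color) (f : V -> color -> rat) :
  reducible A s -> {in s, forall v, kind_ok A s v (K v)} ->
  exists phi : V -> color,
    [/\ {in s, forall v, kind_al psi (K v) (phi v)},
        {in s &, forall x y, okc x y (phi x) (phi y)}
      & \sum_(v <- s) dot (kind_law psi (K v)) (f v) <= \sum_(v <- s) f v (phi v)].
Proof.
case=> _ us fs hs hK.
apply: (forest_coloring (al := fun v => kind_al psi (K v))) => //.
  by move=> v vs; have [[h1 h2 _] h3] := kind_law_law psi (K v); split.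
by move=> u v us' vs nuv; apply: (kind_coupling psi us' vs nuv (hK u us') (hK v vs)).
Qed.

Definition glue (s : seq V) (phi psi : V -> color) : V -> color :=
  fun v => if v \in s then phi v else psi v.

Lemma legal_glue (A : {set V}) (s : seq V) (K : V -> vkind) (phi psi : V -> color) :
  {in s, forall v, kind_ok A s v (K v)} ->
  {in s, forall v, kind_al psi (K v) (phi v)} ->
  {in s &, forall x y, okc x y (phi x) (phi y)} ->
  legal (A :\: [set:: s]) psi -> legal A (glue s phi psi).
Proof.
move=> hK al ok prop.
have cross x y : x \in s -> y \in A -> y \notin s -> okc x y (phi x) (psi y).
  move=> xs yA ys; have := hK x xs; have := al x xs.
  have mok : mult x y = 0%N -> okc x y (phi x) (psi y).
    by move=> m0; rewrite /okc ban_nbr // /nbr m0.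
  case: (K x) => [o k /= alx [[_ _ _ kE h0] _]|b t t' _ [_ _ _ h0 _]|b k _ [_ _ _ h0 _]|_ [h0 _]];
    rewrite /=; try by apply/mok/h0.
  have [yo|yo] := eqVneq y o; last by apply/mok/h0.
  by rewrite okc_sym yo /okc kE.
move=> x y xA yA; rewrite /glue; case: ifPn => xs; case: ifPn => ys.
- exact: ok.
- exact: cross.
- by rewrite okc_sym; apply: cross.
- by apply: prop; rewrite !inE ?xs ?ys.
Qed.

(** The expected value of [f] at a vertex of this kind. For a lost color it is the least one over
    the laws of the outside neighbor that are bounded below by [a]. *)
Definition kind_value (a : rat) (k : vkind) (f : color -> rat) : rat :=
  match k with
  | Lost o k => guarantee a (fun c => dot (law_but (k c)) f)
  | Star _ t _ => dot (star_law (1 / 2) t) f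
  | _ => dot uniform f
  end.

(** The bound 1/4 comes from the star law, which leaves 1/4 to each color other than the center. *)
Lemma guarantee_value (a : rat) (A : {set V}) (s : seq V) (v : V) (k : vkind)
    (f : color -> rat) :
  0 <= a -> a <= 1 / 4 -> kind_ok A s v k -> guarantee a f <= kind_value a k f.
Proof.
move=> a0 a4; case: k => [o k [[_ _ k_inj _ _] _]|b t t' _|b k _|_] /=.
- by apply: guarantee_lost => //; lra.
- by apply: guarantee_star; lra.
- exact: guarantee_uniform.
- exact: guarantee_uniform.
Qed.

Lemma guarantee_sum (a : rat) (I : Type) (r : seq I) (g : I -> color -> rat) :
  3 * a <= 1 ->
  \sum_(i <- r) guarantee a (g i) <= guarantee a (fun c => \sum_(i <- r) g i c).
Proof.
move=> a3; elim: r => [|i r IH].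
  rewrite big_nil; apply: le_trans (_ : guarantee a (fun=> 0) <= _).
    by rewrite guarantee_cst.
  by rewrite -[leLHS]addr0 -[X in _ + X](guarantee_cst a 0);
    apply: guarantee_split => // c; rewrite big_nil addr0.
rewrite big_cons; apply: le_trans (lerD (lexx _) IH) _.
by apply: guarantee_split => // c; rewrite big_cons.
Qed.

(** The law of a vertex that loses a color depends on the color of its outside neighbor [o]. Its
    expected value is therefore handed to [o] as a further weight before the outside is colored, and
    superadditivity of [guarantee] preserves the total. *)
Lemma value_extend (a : rat) (A : {set V}) (s : seq V) (K : V -> vkind) :
  3 * a <= 1 -> reducible A s -> {in s, forall v, kind_ok A s v (K v)} ->
  flexible a (A :\: [set:: s]) -> forall f : V -> color -> rat,
  exists2 phi, legal A phi &
    \sum_(v in A :\: [set:: s]) guarantee a (f v) + \sum_(v <- s) kind_value a (K v) (f v)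
    <= \sum_(v in A) f v (phi v).
Proof.
move=> a3 red hK flex f.
pose B := A :\: [set:: s].
pose w v y c : rat := if K v is Lost o k then
  (if y == o then dot (law_but (k c)) (f v) else 0) else 0.
pose rest v : rat := if K v is Lost _ _ then 0 else kind_value a (K v) (f v).
have [_ us _ hs] := red.
have sA : [set:: s] \subset A by apply/subsetP => v; rewrite inE => /hs[].
have single (o : V) (F : V -> rat) : o \in B ->
    \sum_(y in B) (if y == o then F y else 0) = F o.
  by move=> oB; rewrite (bigD1 o) //= eqxx big1 ?addr0 // => y /andP[_ /negPf->].
have [psi prop hpsi] := flex (fun y c => f y c + \sum_(v <- s) w v y c).
have [phi [al ok hphi]] := reducible_coloring psi f red hK.
exists (glue s phi psi); first exact: legal_glue hK al ok prop.
have -> : \sum_(v in A) f v (glue s phi psi v) =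
    \sum_(v in B) f v (psi v) + \sum_(v <- s) f v (phi v).
  rewrite (big_setID [set:: s]) /= addrC; congr (_ + _).
    by apply: eq_bigr => v; rewrite /glue !inE => /andP[/negPf->].
  rewrite (setIidPr sA) [RHS]big_uniq //; apply: eq_big => v; first by rewrite inE.
  by rewrite inE /glue => ->.
have lawE v : v \in s -> dot (kind_law psi (K v)) (f v) =
    \sum_(y in B) w v y (psi y) + rest v.
  move=> vs; have := hK v vs; rewrite /w /rest; case: (K v) => [o k|b t t'|b k|] /=.
  - by case=> [[oA os _ _ _] _]; rewrite single ?addr0 // !inE os.
  - by rewrite big1 ?add0r.
  - by rewrite big1 ?add0r.
  - by rewrite big1 ?add0r.
have valE v : v \in s -> kind_value a (K v) (f v) =
    \sum_(y in B) guarantee a (w v y) + rest v.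
  have G0 : guarantee a (fun=> 0) = 0 by rewrite guarantee_cst.
  move=> vs; have := hK v vs; rewrite /w /rest; case: (K v) => [o k|b t t'|b k|] /=.
  - case=> [[oA os _ _ _] _]; rewrite addr0.
    rewrite -(single o (fun=> guarantee a (fun c => dot (law_but (k c)) (f v)))) ?inE ?os //.
    by apply: eq_bigr => y _; case: eqP.
  - by rewrite big1 ?add0r.
  - by rewrite big1 ?add0r.
  - by rewrite big1 ?add0r.
apply: le_trans (lerD (lexx _) hphi); rewrite (eq_big_seq _ lawE) (eq_big_seq _ valE).
rewrite !big_split /= !addrA lerD2r.
rewrite [X in _ + X <= _]exchange_big /= [X in _ <= _ + X]exchange_big /=.
rewrite -!big_split /=; apply: le_trans hpsi; apply: ler_sum => y _.
apply: le_trans (lerD (lexx _) (guarantee_sum s (fun v => w v y) a3)) _.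
exact: guarantee_split.
Qed.

Lemma flexible_reducible (a : rat) (A : {set V}) (s : seq V) :
  0 <= a -> a <= 1 / 4 -> reducible A s -> flexible a (A :\: [set:: s]) -> flexible a A.
Proof.
move=> a0 a4 red flex f; have [K hK] := reducible_kinds red.
have [|phi prop hphi] := value_extend _ red hK flex f; first by lra.
exists phi => //; apply: le_trans hphi; have [_ us _ hs] := red.
have sA : [set:: s] \subset A by apply/subsetP => v; rewrite inE => /hs[].
rewrite (big_setID [set:: s]) /= addrC lerD2l (setIidPr sA) [leRHS]big_uniq //.
rewrite (eq_bigl (mem s)); last by move=> v; rewrite inE.
by apply: ler_sum => v vs; apply: guarantee_value (hK v vs).
Qed.

End Network.

(** * Surplus *)

Section Legs.

Variable V : network.
Implicit Types (x y u v : V) (A C D N X Y Z : {set V}).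

Definition edges X Y : nat := \sum_(x in X) dg Y x.

Lemma dg_setID X Y v : dg Y v = (dg (Y :&: X) v + dg (Y :\: X) v)%N.
Proof. by rewrite /dg (big_setID X). Qed.

Lemma dg_subset X Y v : X \subset Y -> (dg X v <= dg Y v)%N.
Proof. by move=> XY; rewrite (dg_setID X Y) (setIidPr XY) leq_addr. Qed.

Lemma edges_sym X Y : edges X Y = edges Y X.
Proof.
rewrite /edges /dg exchange_big /=; apply: eq_bigr => y _.
by apply: eq_bigr => x _; rewrite mult_sym.
Qed.

Lemma edges_setIDl X Y Z : edges Y Z = (edges (Y :&: X) Z + edges (Y :\: X) Z)%N.
Proof. by rewrite /edges (big_setID X). Qed.

Lemma edges_setIDr X Y Z : edges Z Y = (edges Z (Y :&: X) + edges Z (Y :\: X))%N.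
Proof. by rewrite 3!(edges_sym Z) (edges_setIDl X). Qed.

Lemma edges_subset X X' Y Y' : X \subset X' -> Y \subset Y' -> (edges X Y <= edges X' Y')%N.
Proof.
move=> XX' YY'; apply: (@leq_trans (edges X Y')).
  by apply: leq_sum => x _; apply: dg_subset.
by rewrite (edges_setIDl X X') (setIidPr XX') leq_addr.
Qed.

Lemma edges1l x Y : edges [set x] Y = dg Y x.
Proof. by rewrite /edges big_set1. Qed.

Lemma edges0l Y : edges set0 Y = 0%N.
Proof. by rewrite /edges big_set0. Qed.

Lemma edges_eq0 X Y x y : edges X Y = 0%N -> x \in X -> y \in Y -> nbr x y = false.
Proof.
move=> /eqP; rewrite sum_nat_eq0 => /forall_inP h xX yY; apply/negbTE.
have /eqP/eqP := h x xX; rewrite sum_nat_eq0 => /forall_inP/(_ y yY)/eqP m0.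
by rewrite /nbr m0.
Qed.

Lemma edges_gt0 X Y : (0 < edges X Y)%N ->
  exists x y, [/\ x \in X, y \in Y & nbr x y].
Proof.
rewrite lt0n sum_nat_eq0 => /forall_inPn[x xX]; rewrite sum_nat_eq0 => /forall_inPn[y yY].
by rewrite -lt0n => h; exists x, y.
Qed.

Definition linked C : Prop :=
  C != set0 /\ forall D, D \subset C -> D != set0 -> D != C -> (0 < edges D (C :\: D))%N.

Lemma linked_component Y : Y != set0 -> exists D,
  [/\ D \subset Y, edges D (Y :\: D) = 0%N & linked D].
Proof.
move=> Y0; pose P D := [&& D \subset Y, D != set0 & edges D (Y :\: D) == 0%N].
have PY : P Y by rewrite /P subxx Y0 setDv edges_sym edges0l.
case: (@arg_minnP _ Y P (fun D => #|D|) PY) => D /and3P[DY D0 /eqP De] Dmin.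
exists D; split=> //; split=> // D' D'D D'0 D'nD; rewrite lt0n; apply/negP => /eqP e0.
have D'Y := subset_trans D'D DY.
have /Dmin : P D'.
  rewrite /P D'Y D'0 /= (edges_setIDr D) -leqn0 -[0%N]addn0 leq_add //.
    rewrite -e0 edges_subset //; apply/subsetP => z; rewrite !inE.
    by case/andP => /andP[-> _] ->.
  rewrite -De edges_subset //; apply/subsetP => z; rewrite !inE.
  by case/and3P=> -> _ ->.
by rewrite leqNgt proper_card // properEneq D'nD.
Qed.

(* Each edge leaving [C] inside [A] counts once, each edge inside [C] twice. *)
Definition surplus A C : int := 3 * #|C|%:Z - (edges C A)%:Z.

Lemma surplus_setID A X C : surplus A C = surplus A (C :&: X) + surplus A (C :\: X).
Proof. by rewrite /surplus (edges_setIDl X C) -(cardsID X C); lia. Qed.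

(* But for one edge too many at its root [u], a leg would be reducible. *)
Definition leg A C N (s : seq V) u : Prop :=
  [/\ uniq (rcons s u), forest (rcons s u), {subset rcons s u <= C},
      {in s, forall v, v \notin N /\ (dg A v <= (nb (rcons s u) v).+1)%N}
    & u \in N /\ (dg A u <= (nb (rcons s u) u).+2)%N].

Lemma forest_cat (s t : seq V) u :
  forest (rcons s u) -> forest t -> {in s & t, forall v y, ~~ nbr v y} ->
  (nb t u <= 1)%N -> forest (rcons s u ++ t).
Proof.
elim: s => [|v s IH] /=; first by move=> _ ft _ ut; rewrite ft andbT.
case/andP => hv fs ft nst ut; rewrite IH // ?andbT.
  have c0 : count (nbr v) t = 0%N.
    apply/eqP; rewrite -leqn0 leqNgt -has_count; apply/hasPn => y yt.
    by apply: nst => //; rewrite mem_head.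
  by rewrite count_cat c0 addn0.
by move=> v' y v's yt; apply: nst => //; rewrite inE v's orbT.
Qed.

Section NoReducible.

Variable A : {set V}.
Hypothesis irred : forall s, ~ reducible A s.

(** The vertex [u] contributes [3 - dg A u] to the surplus of [C], and each component of [C :\ u]
    contributes at most 1, by induction. If every component contributing 1 sends a leg to [u], then
    [dg A u] exceeds the number of neighbors of [u] in the resulting forest by at most
    [3 - surplus A C]. A surplus of 2 or more would thus give a reducible forest, and a surplus of 1
    gives a leg. *)
Lemma leg_exists n C : C \subset A -> (#|C| <= n)%N -> linked C ->
  1 <= surplus A C -> forall N, (exists2 u, u \in C & u \in N) ->
  surplus A C = 1 /\ exists s u, leg A C N s u.
Proof.
elim: n C => [|n IH] C CA Cn linkC.
  by case: linkC; rewrite -card_gt0; move: Cn; case: #|C|.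
(* Unless some leg of a component of [Y] ends in [N], legs ending at neighbors
   of [u] are joined at [u]. *)
have star_legs u k Y : (#|Y| <= k)%N -> (#|Y| <= n)%N -> Y \subset A -> u \notin Y ->
    (forall D, D \subset Y -> D != set0 -> edges D (Y :\: D) = 0%N ->
       exists2 y, y \in D & nbr u y) -> forall N,
    (exists s u', leg A Y N s u') \/
    exists s, [/\ uniq s, forest (rcons s u), {subset s <= Y},
      {in s, forall v, v \notin N /\ (dg A v <= (nb (rcons s u) v).+1)%N}
      & surplus A Y <= (nb s u)%:Z].
  elim: k Y => [|k IHk] Y Yk Yn YA uY touch N.
    right; exists [::]; split=> //.
    by move: Yk; rewrite leqn0 cards_eq0 => /eqP->; rewrite /surplus cards0 edges0l.
  have [->|Y0] := eqVneq Y set0.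
    by right; exists [::]; split=> //; rewrite /surplus cards0 edges0l.
  have [D [DY De linkD]] := linked_component Y0.
  have D0 : (0 < #|D|)%N by rewrite card_gt0; case: linkD.
  have cardD : (#|Y :\: D| + #|D|)%N = #|Y| by rewrite -(cardsID D Y) (setIidPr DY) addnC.
  have surD : surplus A Y = surplus A D + surplus A (Y :\: D).
    by rewrite (surplus_setID _ D) (setIidPr DY).
  have YDA : Y :\: D \subset A by rewrite (subset_trans _ YA) ?subsetDl.
  have uYD : u \notin Y :\: D by rewrite inE (negPf uY) andbF.
  have touchD (E : {set V}) : E \subset Y :\: D -> E != set0 -> edges E ((Y :\: D) :\: E) = 0%N ->
      exists2 y, y \in E & nbr u y.
    move=> EYD E0 Ee; apply: touch => //; first by rewrite (subset_trans EYD) ?subsetDl.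
    apply/eqP; rewrite (edges_setIDr D) -leqn0 -[0%N]addn0 leq_add //.
      rewrite -De edges_sym edges_subset //.
      by apply/subsetP => z; rewrite !inE => /andP[].
    rewrite -Ee edges_subset //; apply/subsetP => z; rewrite !inE.
    by case/and3P => -> -> ->.
  have Yk' : (#|Y :\: D| <= k)%N by clear -Yk cardD D0; lia.
  have Yn' : (#|Y :\: D| <= n)%N by clear -Yn cardD; lia.
  have Dn : (#|D| <= n)%N by clear -Yn cardD; lia.
  have [[s [u' [us fs sY sN uN]]]|[s [us fs sY sN sur]]] :=
      IHk (Y :\: D) Yk' Yn' YDA uYD touchD N.
    left; exists s, u'; split=> // v vs.
    by have := sY v vs; rewrite inE => /andP[].
  have sY' : {subset s <= Y} by move=> v /sY; rewrite inE => /andP[].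
  have [le0|ge1] : surplus A D <= 0 \/ 1 <= surplus A D by clear; lia.
    by right; exists s; split=> //; clear -sur surD le0; lia.
  have [y yD uy] := touch D DY (proj1 linkD) De.
  (* The neighbors of [u] join [N] so that only the root of the new leg can touch [u], which keeps
     the union a forest. The edge to [u] also lowers the excess of that root from 2 to 1. *)
  have [|s1D [s1 [u1 [us1 fs1 sD sN1 [uN1 du1]]]]] :=
      IH D (subset_trans DY YA) Dn linkD ge1 (N :|: [set y | nbr u y]).
    by exists y => //; rewrite !inE uy orbT.
  have far v z : v \in D -> z \in s -> nbr v z = false.
    by move=> vD zs; apply: edges_eq0 De vD _; apply: sY.
  have u1D : u1 \in D by apply: sD; rewrite mem_rcons mem_head.
  have s1D' v : v \in s1 -> v \in D by move=> vs; apply: sD; rewrite mem_rcons inE vs orbT.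
  have [u1N|u1N] := boolP (u1 \in N).
    left; exists s1, u1; split=> //; first by move=> v /sD; apply: (subsetP DY).
    by move=> v vs; have [] := sN1 v vs; rewrite !inE negb_or => /andP[].
  have uu1 : nbr u u1 by move: uN1; rewrite !inE (negPf u1N).
  have nbs v : v \in D -> nb s v = 0%N.
    move=> vD; apply/eqP; rewrite -leqn0 leqNgt -has_count; apply/hasPn => z zs.
    by rewrite far.
  have nbr1 (t : seq V) v z : nb (rcons t z) v = (nb t v + nbr v z)%N.
    by rewrite /nb -cats1 count_cat /= addn0.
  right; exists (rcons s1 u1 ++ s); rewrite rcons_cat; split.
  - rewrite cat_uniq us1 us andbT /=; apply/hasPn => v /sY.
    by rewrite inE => /andP[vD _]; apply: contra vD => /sD.
  - apply: forest_cat => //; last by rewrite nbr1 nbs //; case: nbr.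
    move=> v z vs1; rewrite mem_rcons inE => /predU1P[->|zs]; last first.
      by rewrite far // s1D'.
    by have [] := sN1 v vs1; rewrite !inE negb_or nbr_sym => /andP[].
  - by move=> v; rewrite mem_cat => /orP[/sD/(subsetP DY)|/sY'].
  - have nbcat v : nb (rcons s1 u1 ++ rcons s u) v = (nb (rcons s1 u1) v + nb (rcons s u) v)%N.
      by rewrite /nb count_cat.
    move=> v; rewrite mem_cat mem_rcons inE -orbA nbcat => /or3P[/eqP->|vs1|vs].
    + by split=> //; rewrite (nbr1 s) nbs // nbr_sym uu1; clear -du1; lia.
    + have [] := sN1 v vs1; rewrite !inE negb_or => /andP[-> _] h; split=> //.
      by clear -h; lia.
    + by have [-> h] := sN v vs; split=> //; clear -h; lia.
  - have : (nb (rcons s1 u1 ++ s) u = nb (rcons s1 u1) u + nb s u)%N by rewrite /nb count_cat.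
    by rewrite nbr1 uu1; clear -sur s1D surD; lia.
have main u N : u \in C -> u \in N -> 1 <= surplus A C ->
    (exists s u', leg A (C :\ u) N s u') \/
    exists s, leg A C N s u /\ (dg A u)%:Z <= (nb (rcons s u) u)%:Z + 3 - surplus A C.
  move=> uC uN sC; have cardC : #|C| = #|C :\ u|.+1 by rewrite (cardsD1 u C) uC.
  have YC : C :\ u \subset C := subsetDl _ _.
  have Yn : (#|C :\ u| <= n)%N by clear -Cn cardC; lia.
  have [||lg|[s [us fs sY sN sur]]] :=
      star_legs u n (C :\ u) Yn Yn (subset_trans YC CA) _ _ N.
  - by rewrite !inE eqxx.
  - move=> D DY D0 De; have DC := subset_trans DY YC.
    have uD : u \notin D by apply/negP => /(subsetP DY); rewrite !inE eqxx.
    have DnC : D != C by apply: contraNneq uD => ->.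
    have := proj2 linkC D DC D0 DnC; rewrite (edges_setIDr [set u]).
    have -> : C :\: D :\: [set u] = (C :\ u) :\: D.
      by rewrite !setDDl setUC.
    rewrite De addn0 => /edges_gt0[x [y [xD + nxy]]]; rewrite !inE => /andP[_ /eqP yu].
    by exists x => //; rewrite nbr_sym -yu.
  - by left.
  right; exists s.
  have surE : surplus A C = 3 - (dg A u)%:Z + surplus A (C :\ u).
    rewrite (surplus_setID _ [set u]) (setIidPr _) ?sub1set //.
    by rewrite [surplus A [set u]]/surplus cards1 edges1l mulr1.
  have nbE : nb (rcons s u) u = nb s u.
    have nuu : nbr u u = false by rewrite /nbr mult_irrefl.
    by rewrite /nb -cats1 count_cat /= nuu !addn0.
  have uns : u \notin s by apply/negP => /sY; rewrite !inE eqxx.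
  split; last by rewrite nbE; clear -surE sur; lia.
  split=> //; first by rewrite rcons_uniq uns.
    by move=> v; rewrite mem_rcons inE => /predU1P[->//|/sY]; apply: (subsetP YC).
  by split=> //; rewrite nbE; clear -surE sur sC; lia.
move=> sC N [u uC uN]; have s1 : surplus A C = 1.
  apply/eqP; rewrite eq_le sC andbT leNgt; apply/negP => s2.
  (* With [N] reduced to [u], no leg inside [C :\ u] can end in [N]. *)
  have [] := main u [set u] uC (set11 u) sC.
    case=> s [u' [_ _ sY _ [/set1P e _]]]; have := sY u'.
    by rewrite mem_rcons mem_head !inE e eqxx => /(_ isT).
  move=> [s [[us fs sY sN [_ _]] ud]].
  apply: (irred (s := rcons s u)); split=> //; first by case: (s).
  move=> v vs; split; first exact: (subsetP CA) _ (sY v vs).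
  move: vs; rewrite mem_rcons inE => /predU1P[->|/sN[]//]; clear -s2 ud; lia.
split=> //; have [[s [u' [us fs sY sN uN']]]|[s [lg _]]] := main u N uC uN sC.
  exists s, u'; split=> // v vs.
  by have := sY v vs; rewrite inE => /andP[].
by exists s, u.
Qed.

End NoReducible.

End Legs.

(** * Gluing colorings *)

(* The least value of [dot q h] over laws [q] with no weight above 2/5. *)
Definition capped (h : color -> rat) : rat :=
  2 / 5 * sum3 h + 1 / 5 * min3 (fun c => - h c).

Lemma capped_sorted (h : color -> rat) (x y z : color) :
  x != y -> y != z -> x != z -> h x <= h y -> h y <= h z ->
  capped h = 2 / 5 * h x + 2 / 5 * h y + 1 / 5 * h z.
Proof.
move=> xy yz xz hxy hyz; rewrite /capped (sum3_distinct h xy yz xz).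
rewrite (@min3_sorted (fun c => - h c) z y x) ?lerN2 // 1?eq_sym //; lra.
Qed.

Lemma capped_le_dot (q h : color -> rat) :
  sum3 q = 1 -> (forall c, 0 <= q c <= 2 / 5) -> capped h <= dot q h.
Proof.
move=> q1 q2; have [x [y [z [xy yz xz hxy hyz]]]] := sort3 h.
rewrite (capped_sorted xy yz xz hxy hyz) (dot_sorted _ _ xy yz xz).
move: q1; rewrite (sum3_distinct q xy yz xz).
by move: (q2 x) (q2 y) (q2 z) => /andP[? ?] /andP[? ?] /andP[? ?] ?; nra.
Qed.

Lemma capped_uniform (h : color -> rat) : capped h <= dot uniform h.
Proof. by apply: capped_le_dot => [|c]; rewrite /uniform /sum3; lra. Qed.

(** The origin of 2/5: if the outside neighbor takes each color with probability at least 1/5, then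
    each color is lost with probability at least 1/5, and otherwise has weight 1/2. *)
Lemma capped_lost (k : color -> color) (h : color -> rat) : injective k ->
  capped h <= guarantee (1 / 5) (fun c => dot (law_but (k c)) h).
Proof.
move=> k_inj; have [x [y [z [xy yz xz hxy hyz]]]] := sort3 h.
set g := fun c => _.
have Sg : sum3 g = sum3 h.
  have -> : sum3 g = sum3 (fun c => 1/2 * sum3 h - 1/2 * (h \o k) c).
    by rewrite /g /sum3 !dot_law_but.
  have -> : sum3 (fun c => 1/2 * sum3 h - 1/2 * (h \o k) c)
     = 3/2 * sum3 h - 1/2 * sum3 (h \o k) by rewrite /sum3; lra.
  by rewrite (sum3_comp h k_inj); lra.
have Mg : 1/2 * (h x + h y) <= min3 g.
  rewrite /min3 !le_min /g !dot_law_but (sum3_distinct h xy yz xz).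
  have fz c : h c <= h z.
    by have /or3P[/eqP->|/eqP->|/eqP->] := color_cases c xy yz xz; lra.
  by have [h1 h2 h3] := And3 (fz (k None)) (fz (k (Some false))) (fz (k (Some true)));
    apply/and3P; split; lra.
rewrite /guarantee Sg (capped_sorted xy yz xz hxy hyz) (sum3_distinct h xy yz xz); lra.
Qed.

Lemma capped_penalty (d : color) (K : rat) :
  0 <= K -> capped (fun c => if c == d then - K else 0) = - (2 / 5 * K).
Proof.
move=> K0; rewrite /capped /sum3 /min3; move: d => [[]|] /=.
- by rewrite opprK oppr0 (min_idPl K0) minxx; lra.
- by rewrite opprK oppr0 (min_idPr K0) minxx; lra.
- by rewrite opprK oppr0 minxx (min_idPr K0); lra.
Qed.

Section Gluing.

Variable V : network.
Implicit Types (x y u v b p : V) (A D X Y : {set V}).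

Definition mix X (phi psi : V -> color) : V -> color :=
  fun v => if v \in X then phi v else psi v.

Lemma legal_mix A D (phi psi : V -> color) :
  legal D phi -> legal (A :\: D) psi ->
  (forall u v, u \in A :\: D -> v \in D -> okc u v (psi u) (phi v)) ->
  legal A (mix D phi psi).
Proof.
move=> pD pA cross u v uA vA; rewrite /mix.
case: ifPn => uD; case: ifPn => vD.
- exact: pD.
- by rewrite okc_sym; apply: cross => //; rewrite inE vD.
- by apply: cross => //; rewrite inE uD.
- by apply: pA; rewrite inE ?uD ?vD.
Qed.

Lemma sum_mix A D (f : V -> color -> rat) (phi psi : V -> color) : D \subset A ->
  \sum_(v in A) f v (mix D phi psi v) =
  \sum_(v in A :\: D) f v (psi v) + \sum_(v in D) f v (phi v).
Proof.
move=> DA; rewrite (big_setID D) /= (setIidPr DA) addrC.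
congr (_ + _); apply: eq_bigr => v; last by rewrite /mix => ->.
by rewrite /mix inE => /andP[/negPf->].
Qed.

Lemma flexible_union (a : rat) A D : D \subset A -> edges D (A :\: D) = 0%N ->
  flexible a D -> flexible a (A :\: D) -> flexible a A.
Proof.
move=> DA e0 fD fA f; have [phi pphi hphi] := fD f; have [psi ppsi hpsi] := fA f.
exists (mix D phi psi).
  apply: legal_mix => // u v uA vD; rewrite /okc ban_nbr // nbr_sym.
  by rewrite (edges_eq0 e0).
by rewrite sum_mix // (big_setID D) /= (setIidPr DA) addrC lerD.
Qed.

Lemma best_coloring D (Q : pred (V -> color)) (f : V -> color -> rat) :
  (forall phi psi, phi =1 psi -> Q phi = Q psi) ->
  (exists2 phi, legal D phi & Q phi) ->
  exists phi, [/\ legal D phi, Q phi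
    & forall psi, legal D psi -> Q psi ->
      \sum_(v in D) f v (psi v) <= \sum_(v in D) f v (phi v)].
Proof.
move=> Qext [phi0 pphi0 Qphi0].
pose P (g : {ffun V -> color}) :=
  [forall x in D, forall y in D, okc x y (g x) (g y)] && Q g.
have toP phi : legal D phi -> Q phi -> P [ffun v => phi v].
  move=> pphi Qphi; apply/andP; split.
    by apply/forall_inP => x xD; apply/forall_inP => y yD; rewrite !ffunE; apply: pphi.
  by rewrite -(Qext phi) // => v; rewrite ffunE.
case: (@arg_maxP _ _ _ _ P (fun g : {ffun V -> color} => \sum_(v in D) f v (g v)) (toP _ pphi0 Qphi0)).
move=> g /andP[/forall_inP pg Qg] gmax; exists g; split=> //.
  by move=> x y xD yD; have /forall_inP := pg x xD; apply.
move=> psi ppsi Qpsi; have := gmax _ (toP _ ppsi Qpsi); apply: le_trans.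
by rewrite le_eqVlt; apply/orP; left; apply/eqP/eq_bigr => v _; rewrite ffunE.
Qed.

(* The dual form of: [D] has a distribution of colorings in which no color of
   [p] has probability above 2/5. *)
Definition evenly_flexible D p : Prop :=
  forall (f : V -> color -> rat) (h : color -> rat), exists2 phi, legal D phi &
    \sum_(v in D) guarantee (1 / 5) (f v) + capped h
    <= \sum_(v in D) f v (phi v) + h (phi p).

(** [phi] is best overall, and [phi'] is best among the colorings with another color at [p]. In a
    distribution with the cap 2/5 at [p], colorings that use [phi p] there have total probability at
    most 2/5 and are worth at most [phi]; all others are worth at most [phi']. *)
Lemma evenly_flexible_two D p (f : V -> color -> rat) : evenly_flexible D p ->
  exists phi phi', [/\ legal D phi, legal D phi', phi p != phi' p,
    \sum_(v in D) f v (phi' v) <= \sum_(v in D) f v (phi v)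
    & \sum_(v in D) guarantee (1 / 5) (f v) <=
      2 / 5 * \sum_(v in D) f v (phi v) + 3 / 5 * \sum_(v in D) f v (phi' v)].
Proof.
move=> flex; set B := \sum_(v in D) _; pose val phi := \sum_(v in D) f v (phi v).
have pen (d : color) (K : rat) : 0 <= K -> exists2 phi, legal D phi &
    B - 2 / 5 * K <= val phi + (if phi p == d then - K else 0).
  move=> K0; have [phi pphi hphi] := flex f (fun c => if c == d then - K else 0).
  by exists phi => //; rewrite capped_penalty in hphi.
have [phi0 pphi0 hphi0] := pen None 0 (lexx _).
have [|phi [pphi _ phimax]] := @best_coloring D xpredT f (fun _ _ _ => erefl).
  by exists phi0.
pose W := val phi; pose T := (B - 2 / 5 * W) * (5 / 3).
have BW : B <= W.
  by have := phimax _ pphi0 isT; rewrite -/(val phi0) -/(val phi) -/W; case: ifP hphi0; lra.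
have near e : 0 < e -> exists2 psi, legal D psi & (psi p != phi p) && (T - 2 / 5 * e <= val psi).
  move=> e0; have [|psi ppsi hpsi] := pen (phi p) (W - T + e); first by rewrite /T; lra.
  exists psi => //; move: hpsi; case: eqP => [_|_] hpsi /=; last by rewrite /T in hpsi *; lra.
  by have := phimax _ ppsi isT; rewrite -/(val psi) -/(val phi) -/W /T in hpsi *; lra.
have ext (g h : V -> color) : g =1 h -> (g p != phi p) = (h p != phi p) by move=> ->.
have [|psi [ppsi psip psimax]] := @best_coloring D (fun psi => psi p != phi p) f ext.
  by have [psi ppsi /andP[? _]] := near 1 ltr01; exists psi.
exists phi, psi; split; [exact: pphi | exact: ppsi | by rewrite eq_sym | exact: phimax |].
rewrite -/(val phi) -/W -/(val psi).
have [|lt] := leP T (val psi); first by rewrite /T; lra.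
have [|psi' ppsi' /andP[psip' hpsi']] := near (T - val psi); first by lra.
by have := psimax _ ppsi' psip'; rewrite -/(val psi) -/(val psi'); lra.
Qed.

(** Once [x] is colored, [D] takes [phi] unless the bridge bans its color at [p], and then [phi'].
    Seen from [x], this is worth [W'] for one color and [W] for the other two, and the guarantee
    with 1/5 of such a weight is at least [2 / 5 * W + 3 / 5 * W'], just what even flexibility
    provides. *)
Lemma flexible_bridge A D x p : D \subset A -> x \in A :\: D -> p \in D ->
  mult x p = 1%N ->
  {in A :\: D & D, forall u v, nbr u v -> u = x /\ v = p} ->
  flexible (1 / 5) (A :\: D) -> evenly_flexible D p -> flexible (1 / 5) A.
Proof.
move=> DA xA pD mxp bridge fA fD f.
have [k k_inj kE] := ban_single mxp.
have [phi [phi' [pphi pphi' ne le_phi hphi]]] := evenly_flexible_two f fD.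
set W := \sum_(v in D) f v (phi v) in le_phi hphi.
set W' := \sum_(v in D) f v (phi' v) in le_phi hphi.
pose e c := if k c == phi p then W' else W.
have he : 2 / 5 * W + 3 / 5 * W' <= guarantee (1 / 5) e.
  have D3 c c' : c != c' -> k c != k c' by rewrite (inj_eq k_inj).
  have d1 := negPf (D3 None (Some false) isT); have d2 := negPf (D3 None (Some true) isT).
  have d3 := negPf (D3 (Some false) (Some true) isT).
  have minW : W' <= min3 e by rewrite /min3 !le_min /e; do 3! case: ifP => _; rewrite ?lexx ?le_phi.
  suff sumW : sum3 e = 2 * W + W' by rewrite /guarantee sumW; clear -minW; lra.
  have /or3P[/eqP h|/eqP h|/eqP h] :=
      color_cases (phi p) (negbT d1) (negbT d3) (negbT d2); rewrite /sum3 /e h ?eqxx.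
  - by rewrite (eq_sym _ (k None)) d1 (eq_sym _ (k None)) d2; clear; lra.
  - by rewrite d1 (eq_sym _ (k (Some false))) d3; clear; lra.
  - by rewrite d2 d3; clear; lra.
have [psi ppsi hpsi] := fA (fun y c => f y c + if y == x then e c else 0).
exists (mix D (if k (psi x) == phi p then phi' else phi) psi).
  apply: legal_mix => //; first by case: ifP.
  move=> u v uA vD; have [nuv|] := boolP (nbr u v); last by rewrite /okc => /ban_nbr->.
  have [-> ->] := bridge u v uA vD nuv; rewrite /okc kE.
  by case: ifP => [/eqP->|/negbT]; rewrite eq_sym.
have single (F : V -> rat) : \sum_(y in A :\: D) (if y == x then F y else 0) = F x.
  by rewrite (bigD1 x) //= eqxx big1 ?addr0 // => y /andP[_ /negPf->].
rewrite sum_mix // (big_setID D) /= (setIidPr DA) addrC.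
rewrite [leRHS]big_split /= single in hpsi.
have -> : \sum_(v in D) f v ((if k (psi x) == phi p then phi' else phi) v) = e (psi x).
  by rewrite /e; case: ifP.
apply: le_trans hpsi; apply: le_trans (lerD (lexx _) (le_trans hphi he)) _.
rewrite -(single (fun=> guarantee (1 / 5) e)) -big_split /=; apply: ler_sum => y _.
case: eqP => [_|_]; first exact: (guarantee_split fifth3_le1 (fun=> erefl)).
rewrite addr0 (@guarantee_ext _ (f y) (fun c => f y c + 0)); last by move=> c; rewrite addr0.
exact: lexx.
Qed.

(** A uniform law gives 1/3 and a lost color at most 2/5, within the cap. A star gives 1/2 to its
    center, hence its exclusion. *)
Lemma evenly_flexible_reducible D s (K : V -> vkind V) p :
  reducible D s -> {in s, forall v, kind_ok D s v (K v)} -> p \in s ->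
  (if K p is Star _ _ _ then False else True) ->
  flexible (1 / 5) (D :\: [set:: s]) -> evenly_flexible D p.
Proof.
move=> red hK ps nostar flex f h; have [_ us _ hs] := red.
have sD : [set:: s] \subset D by apply/subsetP => v; rewrite inE => /hs[].
have [phi pphi hphi] := value_extend fifth3_le1 red hK flex
  (fun v c => f v c + if v == p then h c else 0).
exists phi; first exact: pphi.
have pD : p \in D by have [] := hs p ps.
have single : \sum_(v in D) (if v == p then h (phi v) else 0) = h (phi p).
  by rewrite (bigD1 p) //= eqxx big1 ?addr0 // => v /andP[_ /negPf->].
rewrite [leRHS]big_split /= single in hphi.
apply: le_trans hphi; rewrite (big_setID [set:: s]) /= (setIidPr sD) addrAC addrC.
have off v (r : rat) : v != p -> guarantee r (f v) =
    guarantee r (fun c => f v c + (if v == p then h c else 0)).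
  by move=> /negPf vp; apply: guarantee_ext => c; rewrite vp addr0.
apply: lerD.
  apply: ler_sum => v; rewrite inE => /andP[vs _].
  have vp : v != p by apply: contraNneq vs => ->; rewrite inE.
  rewrite (off v _ vp); exact: lexx.
have -> : \sum_(v in [set:: s]) guarantee (1 / 5) (f v) = \sum_(v <- s) guarantee (1 / 5) (f v).
  by rewrite (big_uniq _ us); apply: eq_bigl => v; rewrite inE.
have -> : capped h = \sum_(v <- s) (if v == p then capped h else 0).
  rewrite (bigD1_seq p ps us) /= eqxx big1 ?addr0 // => v /negPf-> //.
rewrite -big_split /= !(big_uniq _ us); apply: ler_sum => v vs.
have a0 : 0 <= 1 / 5 :> rat by clear; lra.
have a4 : 1 / 5 <= 1 / 4 :> rat by clear; lra.
have [e|vp] := eqVneq v p; last first.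
  by rewrite addr0 (off v _ vp) (negPf vp); exact: (guarantee_value _ a0 a4 (hK v vs)).
rewrite e; apply: le_trans (lerD (guarantee_value (f p) a0 a4 (hK p ps)) (lexx _)) _.
have hu : dot uniform (f p) + capped h <= dot uniform (fun c => f p c + h c).
  rewrite (@dotD uniform (f p) h (fun c => f p c + h c) (fun=> erefl)).
  by rewrite lerD2l; apply: capped_uniform.
move: (hK p ps) nostar; case: (K p) => [o k|b t t'|b k|]; rewrite /kind_ok /kind_value.
- move=> [[_ _ k_inj _ _] _] _.
  apply: le_trans (lerD (lexx _) (capped_lost h k_inj)) _.
  by apply: (guarantee_split fifth3_le1) => c; apply: dotD.
- by move=> _ [].
- by move=> _ _; exact: hu.
- by move=> _ _; exact: hu.
Qed.

(** Centers of weights 2/5 at [p] and 3/5 at [b] still couple. The probabilities are then 2/5, 3/10,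
    3/10 at [p] and 3/5, 1/5, 1/5 at [b], which meets the cap at [p] and the lower bound 1/5 at
    both. *)
Lemma evenly_flexible_star p b t t' : mult p b = 2%N -> star (okc p b) t t' ->
  evenly_flexible [set p; b] p.
Proof.
move=> mpb st f h.
have pb : p != b by apply/eqP => e; move: mpb; rewrite e mult_irrefl.
pose law v := if v == p then star_law (2 / 5) t else star_law (3 / 5) t'.
have lawp : law p = star_law (2 / 5) t by rewrite /law eqxx.
have lawb : law b = star_law (3 / 5) t' by rewrite /law eq_sym (negPf pb).
have npb : nbr p b by rewrite /nbr mpb.
have up : uniq [:: p; b] by rewrite /= inE pb.
have lawP (th : rat) (u : color) : 0 <= th -> th <= 1 ->
    [/\ forall c, 0 <= star_law th u c, sum3 (star_law th u) = 1
      & forall c, ~~ xpredT c -> star_law th u c = 0].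
  move=> th0 th1; split; [|exact: sum3_star_law|by []].
  by move=> c; rewrite /star_law; case: ifP => _; clear -th0 th1; lra.
have fp : forest [:: p; b] by rewrite /= npb.
have lawsP : {in [:: p; b], forall v, [/\ forall c, 0 <= law v c, sum3 (law v) = 1
    & forall c, ~~ xpredT c -> law v c = 0]}.
  move=> v; rewrite !inE => /orP[]/eqP->; rewrite ?lawp ?lawb; apply: lawP; clear; lra.
have nn v : nbr v v = false by rewrite /nbr mult_irrefl.
have couple : {in [:: p; b] &, forall u v, nbr u v ->
    coupling (okc u v) xpredT xpredT (law u) (law v)}.
  move=> u v; rewrite !inE => /orP[]/eqP-> /orP[]/eqP->; [by rewrite nn| | |by rewrite nn].
    by move=> _; rewrite lawp lawb; apply: coupling_star st _; [clear; lra | clear; lra | ].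
  by move=> _; rewrite lawp lawb; apply: coupling_star (star_sym st) _; [clear; lra | clear; lra | ].
have [phi [_ ok hphi]] := forest_coloring up fp lawsP couple
    (fun v c => f v c + if v == p then h c else 0).
have sum2 (F : V -> rat) : \sum_(v in [set p; b]) F v = F p + F b.
  by rewrite big_setU1 ?inE //= big_set1.
exists phi.
  by move=> u v; rewrite !inE => hu hv; apply: ok; rewrite !inE.
have bp : (b == p) = false by rewrite eq_sym (negPf pb).
have dp : dot (law p) (fun c => f p c + (if p == p then h c else 0)) =
    dot (star_law (2 / 5) t) (f p) + dot (star_law (2 / 5) t) h.
  by rewrite lawp; apply: dotD => c; rewrite eqxx.
have db : dot (law b) (fun c => f b c + (if b == p then h c else 0)) =
    dot (star_law (3 / 5) t') (f b).
  by rewrite lawb bp /dot /sum3 !addr0.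
move: hphi; rewrite !sum2 !big_cons !big_nil dp db eqxx bp !addr0.
have hb : guarantee (1 / 5) (f b) <= dot (star_law (3 / 5) t') (f b).
  by apply: guarantee_star; clear; lra.
have hp : guarantee (1 / 5) (f p) <= dot (star_law (2 / 5) t) (f p).
  by apply: guarantee_star; clear; lra.
have hh : capped h <= dot (star_law (2 / 5) t) h.
  apply: capped_le_dot => [|c]; first exact: sum3_star_law.
  by rewrite /star_law; case: ifP => _; clear; lra.
move=> hphi; rewrite [leLHS]addrAC [leRHS]addrAC.
exact: le_trans (lerD (lerD hp hh) hb) hphi.
Qed.

End Gluing.

(** * Alternating paths *)

Section Alternating.

Variable V : network.
Implicit Types (x y u v q r : V) (h t : seq V).

(* [d] tells whether the first edge must be double. *)
Fixpoint alternating (d : bool) x h : bool :=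
  if h is y :: h' then (d < mult x y)%N && alternating (~~ d) y h' else true.

Lemma alternating_rev_cat (d : bool) q h t :
  alternating d q h -> alternating (~~ d) q t ->
  alternating (~~ d (+) odd (size h)) (last q h) (rev (belast q h) ++ t).
Proof.
elim: h d q t => [|y h IH] d q t /=; first by rewrite addbF.
case/andP => dqy alt_h alt_t; have := IH (~~ d) y (q :: t) alt_h.
rewrite negbK /= mult_sym dqy => /(_ alt_t).
by rewrite rev_cons cat_rcons addbN addNb negbK.
Qed.

(** An odd number of edges makes the last edge double as well, so the relation is symmetric. *)
Definition joined (A : pred V) x y : Prop := exists h,
  [/\ alternating true x h, odd (size h), last x h = y, uniq (x :: h)
    & {subset x :: h <= A}].

Lemma mem_rev_belast x h y : (y \in last x h :: rev (belast x h)) = (y \in x :: h).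
Proof. by rewrite [in RHS]lastI mem_rcons !inE mem_rev. Qed.

Lemma joined_sym (A : pred V) x y : joined A x y -> joined A y x.
Proof.
case=> h [alt_h odd_h <- uh hA]; exists (rev (belast x h)).
have := alternating_rev_cat (t := [::]) alt_h isT; rewrite odd_h cats0 => alt_r.
split=> //.
- by rewrite size_rev size_belast.
- by case: h {alt_h odd_h uh hA alt_r} => //= y' h; rewrite rev_cons last_rcons.
- move: uh; rewrite lastI rcons_uniq -rev_uniq => /andP[h1 h2].
  by rewrite /= mem_rev h1.
- by move=> v; rewrite mem_rev_belast; apply: hA.
Qed.

Definition want (b : bool) (c0 : color) : pred color := fun c => (c == c0) == b.

(** A weight of 1 or -1 on the color [c0] of [r], and none elsewhere, turns the bound on the total
    weight into the requirement at [r]. *)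
Lemma forest_want (t : seq V) (al : V -> pred color) (p : V -> color -> rat) r b c0 :
  uniq t -> forest t ->
  {in t, forall v, law (p v) /\ forall c, ~~ al v c -> p v c = 0} ->
  {in t &, forall u v, (1 < mult u v)%N ->
     coupling (okc u v) (al u) (al v) (p u) (p v)} ->
  r \in t -> (if b then 0 < p r c0 else p r c0 < 1) ->
  exists phi : V -> color, [/\ {in t, forall v, al v (phi v)},
    {in t &, forall x y, okc x y (phi x) (phi y)} & want b c0 (phi r)].
Proof.
move=> ut ft ps cp rt pr.
have ps' : {in t, forall v, [/\ forall c, 0 <= p v c, sum3 (p v) = 1
                     & forall c, ~~ al v c -> p v c = 0]}.
  by move=> v vt; have [[h1 h2 _] h3] := ps v vt.
have cp' : {in t &, forall u v, nbr u v -> coupling (okc u v) (al u) (al v) (p u) (p v)}.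
  move=> u v ut' vt nuv; have [m1|m2] := leqP (mult u v) 1; last exact: cp.
  have {}m1 : mult u v = 1%N by apply/eqP; rewrite eqn_leq m1.
  have [k k_inj kE] := okc_single m1; have [lu _] := ps u ut'; have [lv sv] := ps v vt.
  by apply: coupling_matching k_inj _ lu lv sv => c c'; rewrite kE.
pose e : rat := if b then 1 else - 1.
have [phi [alp okp hphi]] := forest_coloring ut ft ps' cp'
  (fun v c => if v == r then (if c == c0 then e else 0) else 0).
exists phi; split=> //; move: hphi.
have single (F : V -> rat) : \sum_(y <- t) (if y == r then F y else 0) = F r.
  by rewrite (bigD1_seq r rt ut) /= eqxx big1 ?addr0 // => y /negPf -> //.
have -> : \sum_(v <- t) dot (p v) (fun c => if v == r then if c == c0 then e else 0 else 0)
    = p r c0 * e.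
  rewrite -(single (fun v => p v c0 * e)); apply: eq_bigr => v _.
  case: eqP => _; last by rewrite /dot /sum3 !mulr0 !addr0.
  by case: (c0) => [[]|]; rewrite /dot /sum3 /= !mulr0 ?addr0 ?add0r.
rewrite single /want; case: eqP => _; rewrite /e; case: b pr {e} => //= pr.
  by rewrite mulrN1 lerN2 leNgt pr.
by rewrite mulr1 leNgt pr.
Qed.

End Alternating.

(** * Two requirements that block each other in a reducible forest *)

Section Walk.

Variable V : network.
Implicit Types (x y u v q r b : V) (h t : seq V).

Variables (B : {set V}) (s : seq V) (K : V -> vkind V).
Hypothesis red : reducible B s.
Hypothesis kindK : {in s, forall v, kind_ok B s v (K v)}.

Definition lossless (k : vkind V) : bool := if k is Lost _ _ then false else true.

Lemma lossless_al psi k c : lossless k -> kind_al psi k c.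
Proof. by case: k. Qed.

Lemma lossless_law_gt0 psi k c : lossless k -> 0 < kind_law psi k c.
Proof.
by case: k => [o k|b t t'|b k|] //= _; rewrite /star_law /uniform; try case: ifP; lra.
Qed.

Lemma double_lossless q b : q \in s -> b \in s -> (1 < mult q b)%N -> lossless (K q).
Proof.
move=> qs bs m2; move: (kindK qs); case: (K q) => // o k [_ /(_ b bs)].
by rewrite leqNgt m2.
Qed.

Lemma double_unique q b y : q \in s -> b \in s -> (1 < mult q b)%N ->
  y \in s -> (1 < mult q y)%N -> y = b.
Proof.
move=> qs bs m2 ys m2'; have F x : x \in s -> (1 < mult q x)%N -> (mult q x <= 1)%N -> False.
  by move=> _ h1 h2; have := leq_trans h1 h2; rewrite ltnn.
move: (kindK qs); case: (K q) => [o k [_ /(_ b bs)/(F b bs m2)[]]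
  |a t t' [_ _ _ _ ha]|a k [_ _ _ _ ha]|[_ /(_ b bs)/(F b bs m2)[]]];
have [->|/(ha b bs)/(F b bs m2)[]] := eqVneq b a;
by have [->|/(ha y ys)/(F y ys m2')[]] := eqVneq y a.
Qed.

Lemma sublist_coloring psi t r (e : bool) c0 :
  uniq t -> forest t -> {subset t <= s} -> r \in t ->
  (if e then 0 < kind_law psi (K r) c0 else kind_law psi (K r) c0 < 1) ->
  exists phi : V -> color, [/\ {in t, forall v, kind_al psi (K v) (phi v)},
    {in t &, forall x y, okc x y (phi x) (phi y)} & want e c0 (phi r)].
Proof.
move=> ut ft ts rt pr.
apply: (forest_want (al := fun v => kind_al psi (K v)) ut ft _ _ rt pr).
  by move=> v vt; apply: kind_law_law.
move=> u v ut' vt m2; have [us vs] := (ts u ut', ts v vt).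
by apply: (kind_coupling _ us vs _ (kindK us) (kindK vs)); rewrite /nbr (leq_trans _ m2).
Qed.

Definition blocked t q bq cq r br cr : Prop := forall psi phi : V -> color,
  legal (B :\: [set:: s]) psi -> {in t, forall v, kind_al psi (K v) (phi v)} ->
  {in t &, forall x y, okc x y (phi x) (phi y)} ->
  want bq cq (phi q) -> want br cr (phi r) -> False.

Lemma blocked_sym t q bq cq r br cr :
  blocked t q bq cq r br cr -> blocked t r br cr q bq cq.
Proof. by move=> bl psi phi ? ? ? ? ?; apply: (bl psi phi). Qed.

Lemma want_law psi r (e : bool) c0 : lossless (K r) ->
  if e then 0 < kind_law psi (K r) c0 else kind_law psi (K r) c0 < 1.
Proof.
move=> lr; case: e; first exact: lossless_law_gt0.
have [[_ _ /(_ c0) h] _] := kind_law_law psi (K r).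
exact: (le_lt_trans h half_lt1).
Qed.

Lemma blocked_weights t q cq r br cr psi (al : V -> pred color) (p : V -> color -> rat) :
  blocked t q false cq r br cr -> uniq t -> forest t -> {subset t <= s} ->
  legal (B :\: [set:: s]) psi -> q \in t -> r \in t ->
  {in t, forall v, [/\ law (p v), forall c, ~~ al v c -> p v c = 0
    & forall c, al v c -> kind_al psi (K v) c]} ->
  {in t &, forall u v, (1 < mult u v)%N ->
     coupling (okc u v) (al u) (al v) (p u) (p v)} ->
  (forall c, al q c -> c != cq) ->
  (if br then 0 < p r cr else p r cr < 1) -> False.
Proof.
move=> bl ut ft ts ppsi qt rt hp cp alq pr.
have [|phi [alphi ok wr]] := forest_want ut ft _ cp rt pr.
  by move=> v vt; have [] := hp v vt.
apply: (bl psi phi) => //.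
  by move=> v vt; have [_ _] := hp v vt; apply; apply: alphi.
by rewrite /want; apply/eqP/negbTE/alq/alphi.
Qed.

(* If both colors other than [cq] remain at [q], then the constraint at [r] can
   be met, unless the double edge at [q] is a star whose center is [cq]. *)
Lemma blocked_star t q cq r br cr psi :
  blocked t q false cq r br cr -> uniq t -> forest t -> {subset t <= s} ->
  legal (B :\: [set:: s]) psi -> q \in t -> r \in t -> q != r ->
  lossless (K q) -> lossless (K r) ->
  (br -> {in t, forall y, (mult r y <= 1)%N}) ->
  exists b c, [/\ b \in t, mult q b = 2%N & star (okc q b) cq c].
Proof.
move=> bl ut ft ts ppsi qt rt qr lq lr hr.
pose al v : pred color := if v == q then (fun c => c != cq) else kind_al psi (K v).
pose p v := if v == q then law_but cq else kind_law psi (K v).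
have hp : {in t, forall v, [/\ law (p v), forall c, ~~ al v c -> p v c = 0
    & forall c, al v c -> kind_al psi (K v) c]}.
  move=> v vt; rewrite /al /p; case: eqP => [->|_]; last first.
    by have [] := kind_law_law psi (K v); split.
  split; [exact: law_law_but| |by move=> c _; apply: lossless_al].
  by move=> c /negPn/eqP->; rewrite /law_but eqxx.
have pr : if br then 0 < p r cr else p r cr < 1.
  by rewrite /p eq_sym (negPf qr); apply: want_law.
have alq c : al q c -> c != cq by rewrite /al eqxx.
have [/hasP[b bt m2]|/hasPn single] := boolP (has (fun y => 1 < mult q y)%N t); last first.
  case: (blocked_weights bl ut ft ts ppsi qt rt hp _ alq pr) => u v ut' vt m2.
  have uq : u != q.
    by apply: contraL m2 => /eqP->; apply: single.
  have vq : v != q.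
    by apply: contraL m2 => /eqP->; rewrite mult_sym; apply: single.
  rewrite /al /p (negPf uq) (negPf vq).
  by apply: (kind_coupling _ (ts u ut') (ts v vt) _ (kindK (ts u ut')) (kindK (ts v vt)));
    rewrite /nbr (leq_trans _ m2).
have [qs bs] := (ts q qt, ts b bt).
have bq : b != q by apply: contraL m2 => /eqP->; rewrite mult_irrefl.
have away u v : u \in t -> v \in t -> (1 < mult u v)%N ->
    [\/ u = q /\ v = b, u = b /\ v = q | [/\ u != q, u != b, v != q & v != b]].
  move=> ut' vt muv; have [us vs] := (ts u ut', ts v vt).
  have mbq : (1 < mult b q)%N by rewrite mult_sym.
  have mvu : (1 < mult v u)%N by rewrite mult_sym.
  have [uq|uq] := eqVneq u q.
    by rewrite uq in muv *; constructor 1; split=> //; apply: double_unique muv.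
  have [ub|ub] := eqVneq u b.
    by rewrite ub in muv *; constructor 2; split=> //; apply: double_unique muv.
  have [vq|vq] := eqVneq v q.
    by case/eqP: ub; rewrite vq in mvu; apply: double_unique mvu.
  have [vb|vb] := eqVneq v b.
    by case/eqP: uq; rewrite vb in mvu; apply: double_unique mvu.
  by constructor 3.
have coup u v : u \in t -> v \in t -> (1 < mult u v)%N ->
    coupling (okc u v) (kind_al psi (K u)) (kind_al psi (K v))
      (kind_law psi (K u)) (kind_law psi (K v)).
  move=> ut' vt muv.
  by apply: (kind_coupling _ (ts u ut') (ts v vt) _ (kindK (ts u ut')) (kindK (ts v vt)));
    rewrite /nbr (leq_trans _ muv).
move: (kindK qs) coup; case EK: (K q) => [o k|a t0 t1|a k|] //=.
- by rewrite EK in lq.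
- case=> [as_ ma st _ _] coup.
  have ab : a = b by apply: double_unique m2 as_ _ => //; rewrite ma.
  rewrite ab in ma st as_.
  have [t0q|t0q] := eqVneq t0 cq; first by exists b, t1; rewrite -t0q.
  have Kb : kind_law psi (K b) = star_law (1 / 2) t1 /\ lossless (K b).
    have lb : lossless (K b) by apply: (double_lossless bs qs); rewrite mult_sym.
    split=> //; move: (kindK bs) lb; case EKb: (K b) => [o k|a' u0 u1|a' k|] //=.
    + case=> [as' ma' st' _ _] _.
      have aq : a' = q by apply: (double_unique bs qs) => //; rewrite ?ma' // mult_sym.
      by rewrite aq in st'; have [-> _] := star_inj st' (star_sym st).
    + case=> [as' ma' [k_inj kE] _ _] _.
      have aq : a' = q by apply: (double_unique bs qs) => //; rewrite ?ma' // mult_sym.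
      by rewrite aq in kE; case: (star_perfectN (star_sym st)); exists k.
    + by case=> _ /(_ q qs); rewrite leqNgt mult_sym m2.
  case: Kb => Kb lb.
  case: (blocked_weights bl ut ft ts ppsi qt rt hp _ alq pr) => u v ut' vt muv.
  case: (away u v ut' vt muv) => [[-> ->]|[-> ->]|[uq _ vq _]]; last first.
  + by rewrite /al /p (negPf uq) (negPf vq); apply: coup.
  + rewrite /al /p eqxx (negPf bq) Kb; exact: coupling_star_but t0q (star_sym st) _.
  rewrite /al /p eqxx (negPf bq) Kb; apply: coupling_but_star t0q st _ => c.
  exact: lossless_al.
- case=> [as_ ma [k_inj kE] _ _] coup.
  have ab : a = b by apply: double_unique m2 as_ _ => //; rewrite ma.
  rewrite ab in ma kE as_.
  have lb : lossless (K b) by apply: (double_lossless bs qs); rewrite mult_sym.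
  (* Across a perfect matching the partner [b] gives up the color matched with [cq]. It may be [r],
     but then [r] only has to avoid a color, which [law_but] still allows. *)
  pose al' v : pred color := if v == b then (fun c => c != k cq) else al v.
  pose p' v := if v == b then law_but (k cq) else p v.
  have hp' : {in t, forall v, [/\ law (p' v), forall c, ~~ al' v c -> p' v c = 0
      & forall c, al' v c -> kind_al psi (K v) c]}.
    move=> v vt; rewrite /al' /p'; case: eqP => [->|_]; last exact: hp.
    split; [exact: law_law_but| |by move=> c _; apply: lossless_al].
    by move=> c /negPn/eqP->; rewrite /law_but eqxx.
  have alq' c : al' q c -> c != cq by rewrite /al' eq_sym (negPf bq); apply: alq.
  have pr' : if br then 0 < p' r cr else p' r cr < 1.
    rewrite /p'; have [rb|//] := eqVneq r b; case: br hr {pr bl} => [hr|_].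
      by have := hr isT q qt; rewrite rb leqNgt mult_sym m2.
    by have [_ _ /(_ cr) h] := law_law_but (k cq); exact: (le_lt_trans h half_lt1).
  case: (blocked_weights bl ut ft ts ppsi qt rt hp' _ alq' pr') => u v ut' vt muv.
  have [qb qb'] : (q == b = false) /\ (b == b) by rewrite eq_sym (negPf bq).
  case: (away u v ut' vt muv) => [[-> ->]|[-> ->]|[uq ub vq vb]]; last first.
  + by rewrite /al' /p' (negPf ub) (negPf vb) /al /p (negPf uq) (negPf vq); apply: coup.
  + have kK c : k (invF k_inj c) = c by apply: f_invF.
    rewrite /al' /p' /al /p qb !eqxx.
    have -> : law_but cq = law_but (invF k_inj (k cq)) by rewrite invF_f.
    apply: coupling_perfect_but => //; first exact: can_inj kK.
      by move=> c; rewrite okc_sym -{2}(kK c) kE.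
    by move=> c; rewrite invF_f.
  by rewrite /al' /p' qb /al /p !eqxx; apply: coupling_perfect_but.
- by case=> _ /(_ b bs); rewrite leqNgt m2.
Qed.

Hypothesis some_legal : exists psi, legal (B :\: [set:: s]) psi.
Hypothesis all_colors : forall o c, o \in B :\: [set:: s] ->
  exists2 psi, legal (B :\: [set:: s]) psi & psi o = c.

Lemma extend_head psi phi t v c :
  v \notin t -> {in t, forall y, kind_al psi (K y) (phi y)} ->
  {in t &, forall x y, okc x y (phi x) (phi y)} ->
  kind_al psi (K v) c -> {in t, forall y, nbr v y -> okc v y c (phi y)} ->
  {in v :: t, forall y, kind_al psi (K y) (upd phi v c y)} /\
  {in v :: t &, forall x y, okc x y (upd phi v c x) (upd phi v c y)}.
Proof.
move=> vt al ok alc okv.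
have updv : upd phi v c v = c by rewrite /upd eqxx.
have updE y : y \in t -> upd phi v c y = phi y.
  by rewrite /upd; case: eqP => // ->; rewrite (negPf vt).
have okv' y : y \in t -> okc v y c (phi y).
  by move=> yt; have [/okv->//|nv] := boolP (nbr v y); rewrite /okc ban_nbr.
split=> [y|x y]; first by rewrite inE => /predU1P[->|yt]; rewrite ?updv ?updE //; apply: al.
rewrite !inE => /predU1P[->|xt] /predU1P[->|yt]; rewrite ?updv ?updE //.
- by rewrite /okc ban_nbr // /nbr mult_irrefl.
- exact: okv'.
- by rewrite okc_sym; apply: okv'.
- exact: ok.
Qed.

Lemma count_cases (P : pred V) t : uniq t -> (count P t <= 1)%N ->
  {in t, forall y, P y = false} \/
  exists2 u, u \in t & {in t, forall y, P y = (y == u)}.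
Proof.
move=> ut; case E: (count P t) => [|[]] // _; last first.
  by right; have [u uu uP] := count1_witness ut E; exists u.
left=> y yt; apply/negbTE; apply: (hasPn _ y yt).
by rewrite has_count E.
Qed.

(* [h] leads back from [q], which is still to be colored, along vertices whose
   colors are settled. If the last edge was double then the color of [q] is
   forced, otherwise only one color of [q] is lost. *)
Definition end_state t q (e : bool) h u : Prop :=
  [/\ lossless (K q), e -> {in t, forall y, (mult q y <= 1)%N},
      alternating e q h, odd (size h) = e & last q h = u].

Lemma uniq_middle h h' v t : uniq (h ++ h' ++ v :: t) = uniq (v :: h ++ h' ++ t).
Proof.
have := perm_catCA (h ++ h') [:: v] t; rewrite -!catA => /permPl; exact: perm_uniq.
Qed.

Lemma join_histories q h u r h' u' (e : bool) :
  alternating e q h -> odd (size h) = e -> last q h = u ->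
  alternating e r h' -> odd (size h') = e -> last r h' = u' ->
  (~~ e < mult q r)%N -> uniq (q :: h ++ r :: h') -> {subset q :: h ++ r :: h' <= s} ->
  joined (mem s) u u'.
Proof.
move=> alt1 odd1 <- alt2 odd2 <- mqr uh hs; exists (rev (belast q h) ++ r :: h').
have E : last q h :: rev (belast q h) ++ r :: h' =i q :: h ++ r :: h'.
  move=> y; rewrite -cat_cons mem_cat mem_rev_belast -mem_cat //.
split.
- have := alternating_rev_cat (t := r :: h') alt1; rewrite odd1 /= mqr negbK alt2 => /(_ isT).
  by rewrite addNb addbb.
- by rewrite size_cat size_rev size_belast oddD odd1 /= odd2; case: (e).
- by rewrite last_cat.
- rewrite -(@perm_uniq _ (q :: h ++ r :: h')) // uniq_perm //.
  have perm1 : perm_eq (last q h :: rev (belast q h)) (q :: h).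
    by rewrite [in X in perm_eq _ X]lastI perm_sym perm_rcons perm_cons perm_sym perm_rev.
  by rewrite -!cat_cons (perm_uniq (perm_cat perm1 (perm_refl _))).
- by move=> y; rewrite E; apply: hs.
Qed.

(** The head [v] of the order has at most one neighbor left. If it is neither end, it can be colored
    last and is dropped. If it is an end, its requirement passes to that neighbor: across a single
    edge a forced color becomes a banned one, across a star a banned color becomes a forced center.
    So the path alternates until the next vertex is the other end. *)
Lemma blocked_joined t q e c h u r e' c' h' u' :
  uniq t -> forest t -> {subset t <= s} -> q \in t -> r \in t -> q != r ->
  blocked t q e c r e' c' -> end_state t q e h u -> end_state t r e' h' u' ->
  uniq (h ++ h' ++ t) -> {subset h ++ h' <= s} -> joined (mem s) u u'.
Proof.
have [psi0 ppsi0] := some_legal.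
elim: t q e c h u r e' c' h' u' => [|v t IH] // q e c h u r e' c' h' u' /=.
move=> /andP[vt ut] /andP[nb1 ft] ts qt rt qr bl endq endr uh hs.
have ts' : {subset t <= s} by move=> y yt; apply: ts; rewrite inE yt orbT.
have vs : v \in s by apply: ts; rewrite mem_head.
have step q1 e1 c1 h1 u1 r1 e2 c2 h2 u2 : v = q1 -> r1 \in v :: t -> q1 != r1 ->
    blocked (v :: t) q1 e1 c1 r1 e2 c2 -> end_state (v :: t) q1 e1 h1 u1 ->
    end_state (v :: t) r1 e2 h2 u2 -> uniq (h1 ++ h2 ++ v :: t) ->
    {subset h1 ++ h2 <= s} -> joined (mem s) u1 u2.
  move=> vq; rewrite -{}vq inE eq_sym => /predU1P[->|rt1]; first by rewrite eqxx.
  move=> vr bl1 [lv multv alt1 odd1 last1] [lr multr alt2 odd2 last2] uh1 hs1.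
  have rs : r1 \in s := ts' _ rt1.
  have take psi c0 : want e2 c2 c0 -> exists phi : V -> color,
      [/\ {in t, forall y, kind_al psi (K y) (phi y)},
          {in t &, forall x y, okc x y (phi x) (phi y)}, phi r1 = c0 & want e2 c2 (phi r1)].
    move=> w; have [|phi [h3 h4 h5]] := @sublist_coloring psi t r1 true c0 ut ft ts' rt1.
      exact: lossless_law_gt0.
    have h6 : phi r1 = c0 by apply/eqP; move: h5; rewrite /want eqb_id.
    by exists phi; split=> //; rewrite h6.
  have some_want : exists c0, want e2 c2 c0.
    case: (e2); first by exists c2; rewrite /want eqxx.
    have [x [y [cx _ _ _]]] := two_others c2 (fun=> 0).
    by exists x; rewrite /want (eq_sym x) (negPf cx).
  have block psi phi c0 : legal (B :\: [set:: s]) psi -> want e1 c1 c0 ->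
      {in t, forall y, kind_al psi (K y) (phi y)} ->
      {in t &, forall x y, okc x y (phi x) (phi y)} ->
      {in t, forall y, nbr v y -> okc v y c0 (phi y)} -> want e2 c2 (phi r1) -> False.
    move=> ppsi w0 al ok okv wr.
    have [h3 h4] := extend_head vt al ok (lossless_al psi c0 lv) okv.
    apply: (bl1 psi (upd phi v c0)) => //; first by rewrite /upd eqxx.
    by rewrite /upd eq_sym (negPf vr).
  have endr' : end_state t r1 e2 h2 u2.
    by split=> // he y yt; apply: multr => //; rewrite inE yt orbT.
  have uh2 : uniq ((v :: h1) ++ h2 ++ t) by move: uh1; rewrite uniq_middle.
  have hs2 : {subset (v :: h1) ++ h2 <= s}.
    by move=> y; rewrite inE => /predU1P[->//|]; apply: hs1.
  have join : e1 = e2 -> (~~ e1 < mult v r1)%N -> joined (mem s) u1 u2.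
    move=> e12 m1; rewrite -e12 in alt2 odd2.
    apply: (join_histories alt1 odd1 last1 alt2 odd2 last2 m1).
      have /subseq_uniq : subseq (v :: h1 ++ h2 ++ [:: r1]) ((v :: h1) ++ h2 ++ t).
        by rewrite -cat_cons !cat_subseq // sub1seq.
      move=> /(_ uh2); rewrite -cat_cons uniq_middle cats0 => U.
      by rewrite -cat_cons (uniq_middle (v :: h1) [::]).
    move=> y; rewrite inE mem_cat inE => /or4P[/eqP->//|yh|/eqP->//|yh]; apply: hs1.
      by rewrite mem_cat yh.
    by rewrite mem_cat yh orbT.
  case: e1 bl1 block multv alt1 odd1 join => bl1 block multv alt1 odd1 join.
    have w1 : want true c1 c1 by rewrite /want eqxx.
    have [n0|[y yt yP]] := count_cases ut nb1.
      have [c0 wc0] := some_want; have [phi [al ok _ wr]] := take psi0 c0 wc0.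
      by case: (block psi0 phi c1 ppsi0 w1 al ok _ wr) => y yt; rewrite n0.
    have mvy : mult v y = 1%N.
      apply/eqP; rewrite eqn_leq multv // ?inE ?yt ?orbT //=.
      by have := yP y yt; rewrite eqxx.
    have [k k_inj kE] := okc_single mvy.
    have block1 psi phi : legal (B :\: [set:: s]) psi ->
        {in t, forall y, kind_al psi (K y) (phi y)} ->
        {in t &, forall x y, okc x y (phi x) (phi y)} ->
        phi y != k c1 -> want e2 c2 (phi r1) -> False.
      move=> ppsi al ok ne; apply: (block psi phi c1) => // z zt.
      by rewrite yP // => /eqP->; rewrite kE.
    have [yr|yr] := eqVneq y r1.
      have [e2t|e2f] := boolP e2; first by apply: join; rewrite ?e2t // -yr mvy.
      have [c0 wc0 c0k] : exists2 c0, want e2 c2 c0 & c0 != k c1.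
        rewrite /want (negPf e2f).
        have [ck|ck] := eqVneq c2 (k c1).
          have [x [_ [cx _ _ _]]] := two_others c2 (fun=> 0).
          by exists x; [rewrite (eq_sym x) (negPf cx) | rewrite -ck eq_sym].
        have [x /andP[cx kx]] := third_color ck.
        by exists x; rewrite (eq_sym x) // (negPf cx).
      have [phi [al ok pr wr]] := take psi0 c0 wc0.
      by case: (block1 psi0 phi ppsi0 al ok _ wr); rewrite yr pr.
    have ys := ts' y yt.
    have [ly|] := boolP (lossless (K y)).
      apply: (IH y false (k c1) (v :: h1) u1 r1 e2 c2 h2 u2) => //.
        move=> psi phi ppsi al ok wq wr; apply: (block1 psi phi) => //.
        by move: wq; rewrite /want; case: (phi y == k c1).
      by split=> //=; rewrite ?odd1 // mult_sym mvy.
    (* If [y] loses a color to [o], a suitable color of [o] makes the lost color the banned one, so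
       nothing is blocked. *)
    move: (kindK ys); case EK: (K y) => [o k'|||] //= [[oB os k'_inj _ _] _] _.
    have [|psi ppsi psio] := all_colors (invF k'_inj (k c1)) (o := o); first by rewrite !inE os.
    have [c0 wc0] := some_want; have [phi [al ok _ wr]] := take psi c0 wc0.
    case: (block1 psi phi ppsi al ok _ wr).
    by have := al y yt; rewrite EK /= psio f_invF.
  have uvt : uniq (v :: t) by rewrite /= vt.
  have fvt : forest (v :: t) by rewrite /= nb1.
  have [b [cs [bvt m2 st]]] :=
    blocked_star bl1 uvt fvt ts ppsi0 (mem_head _ _) (mem_behead (s := v :: t) rt1) vr lv lr multr.
  have bt : b \in t.
    by move: bvt; rewrite inE => /predU1P[bv|//]; move: m2; rewrite bv mult_irrefl.
  have bs := ts' b bt.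
  have onlyb y : y \in t -> nbr v y -> y = b.
    have nvb : nbr v b by rewrite /nbr m2.
    have [n0|[z zt zP]] := count_cases ut nb1; first by rewrite n0 in nvb.
    move=> yt; rewrite zP // => /eqP->; apply/esym/eqP; by rewrite -zP.
  have [d [_ [c1d _ _ _]]] := two_others c1 (fun=> 0).
  (* When [b] takes the center [cs], every color of [v] except [c1] is allowed, in particular
     [d]. *)
  have block1 psi phi : legal (B :\: [set:: s]) psi ->
      {in t, forall y, kind_al psi (K y) (phi y)} ->
      {in t &, forall x y, okc x y (phi x) (phi y)} ->
      phi b = cs -> want e2 c2 (phi r1) -> False.
    move=> ppsi al ok pc; apply: (block psi phi d) => //.
      by rewrite /want (eq_sym d) (negPf c1d).
    by move=> z zt /(onlyb z zt)->; rewrite st pc eqxx (eq_sym d) (negPf c1d).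
  have [br|br] := eqVneq b r1.
    have e2f : e2 = false.
      case: (e2) multr => // /(_ isT v (mem_head _ _)).
      by rewrite -br mult_sym m2.
    apply: join; rewrite ?e2f // -?br ?m2 //.
  apply: (IH b true cs (v :: h1) u1 r1 e2 c2 h2 u2) => //.
    move=> psi phi ppsi al ok wq wr; apply: (block1 psi phi) => //.
    by apply/eqP; move: wq; rewrite /want eqb_id.
  have mbv : (1 < mult b v)%N by rewrite mult_sym m2.
  split=> //=.
  - exact: double_lossless bs vs mbv.
  - move=> _ y yt; rewrite leqNgt; apply/negP => mby.
    by rewrite -(double_unique bs vs mbv (ts' y yt) mby) yt in vt.
  - by rewrite mult_sym m2.
  - by rewrite odd1.
have [vq|vq] := eqVneq v q.
  by apply: (step q e c h u r e' c' h' u').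
have [vr|vr] := eqVneq v r.
  apply: joined_sym; apply: (step r e' c' h' u' q e c h u) => //.
  - by rewrite eq_sym.
  - exact: blocked_sym.
  - by move: uh; rewrite uniq_catCA.
  - by move=> y; rewrite mem_cat orbC -mem_cat; apply: hs.
have qt' : q \in t by move: qt; rewrite inE eq_sym (negPf vq).
have rt' : r \in t by move: rt; rewrite inE eq_sym (negPf vr).
apply: (IH q e c h u r e' c' h' u') => //.
- move=> psi phi ppsi al ok wq wr.
  have [c0 alc okc0] : exists2 c0, kind_al psi (K v) c0 &
      {in t, forall y, nbr v y -> okc v y c0 (phi y)}.
    have [_ supp] := kind_law_law psi (K v); have [[l0 l1 _] _] := kind_law_law psi (K v).
    have [n0|[y yt yP]] := count_cases ut nb1.
      have [c0 alc _] := dot_le_max (fun=> 0) l0 l1 supp.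
      by exists c0 => // y yt; rewrite n0.
    have nyv : nbr y v by rewrite nbr_sym yP.
    have ys : y \in s := ts' _ yt.
    have [kap kapP _] := kind_coupling psi ys vs nyv (kindK ys) (kindK vs) (fun=> 0).
    have /andP[ok1 al1] := kapP (phi y) (al y yt).
    by exists (kap (phi y)) => // z zt; rewrite yP // => /eqP->; rewrite okc_sym.
  have [h1 h2] := extend_head vt al ok alc okc0.
  apply: (bl psi (upd phi v c0)) => //.
    by rewrite /upd eq_sym (negPf vq).
  by rewrite /upd eq_sym (negPf vr).
- case: endq => h1 h2 h3 h4 h5; split=> // he y yt; apply: h2 => //.
  by rewrite inE yt orbT.
- case: endr => h1 h2 h3 h4 h5; split=> // he y yt; apply: h2 => //.
  by rewrite inE yt orbT.
- by move: uh; rewrite uniq_middle => /andP[].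
Qed.

End Walk.

(** * Flexibility of sparse networks *)

Section Flexibility.

Variable V : network.
Implicit Types (x y u v w q r b p : V) (h t s : seq V) (A B D S Y Z : {set V}).

Definition sparse (k : int) A : Prop :=
  forall Y, Y \subset A -> Y != set0 -> k <= surplus Y Y.

Lemma sparse_subset k A B : B \subset A -> sparse k A -> sparse k B.
Proof. by move=> BA sA Y YB; apply: sA; apply: subset_trans BA. Qed.

Lemma surplus_closed A D : D \subset A -> edges D (A :\: D) = 0%N ->
  surplus A D = surplus D D.
Proof. by move=> DA e0; rewrite /surplus (edges_setIDr D A) e0 (setIidPr DA) addn0. Qed.

(** A component has surplus at least 2, whereas without reducible forests it would have surplus
    exactly 1. *)
Lemma sparse2_reducible B : sparse 2 B -> B != set0 -> exists s, reducible B s.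
Proof.
move=> sB B0; apply: NNPP => nored.
have irred s : ~ reducible B s by move=> red; apply: nored; exists s.
have [D [DB De linkD]] := linked_component B0.
have D2 : 2 <= surplus B D by rewrite surplus_closed //; apply: sB; case: linkD.
have [u uD] := set0Pn _ (proj1 linkD).
have [||D1 _] := leg_exists irred DB (leqnn _) linkD _ (N := [set u]).
- by apply: le_trans D2.
- by exists u => //; rewrite inE.
by rewrite D1 in D2.
Qed.

Lemma reducible_card A s : reducible A s -> (#|A :\: [set:: s]| < #|A|)%N.
Proof.
case=> s0 us _ hs; have sA : [set:: s] \subset A.
  by apply/subsetP => v; rewrite inE => /hs[].
rewrite -(cardsID [set:: s] A) (setIidPr sA) -[X in (X < _)%N]add0n ltn_add2r card_gt0.
case: s s0 {us hs sA} => // v s _; apply/set0Pn; exists v; by rewrite inE mem_head.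
Qed.

Lemma flexible0 a : flexible a (set0 : {set V}).
Proof.
move=> f; exists (fun=> None); first by move=> x y; rewrite inE.
by rewrite !big_set0.
Qed.

Lemma quarter_ge0 : 0 <= 1 / 4 :> rat. Proof. by lra. Qed.
Lemma quarter3_le1 : 3 * (1 / 4) <= 1 :> rat. Proof. by lra. Qed.
Lemma fifth_ge0 : 0 <= 1 / 5 :> rat. Proof. by lra. Qed.
Lemma fifth_le_quarter : 1 / 5 <= 1 / 4 :> rat. Proof. by lra. Qed.

Lemma flexible_quarter B : sparse 2 B -> flexible (1 / 4) B.
Proof.
have [n] := ubnP #|B|; elim: n B => // n IH B Bn sB.
have [->|B0] := eqVneq B set0; first exact: flexible0.
have [s red] := sparse2_reducible sB B0.
apply: (flexible_reducible quarter_ge0 (lexx _) red); apply: IH.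
  by apply: leq_trans (reducible_card red) _.
by apply: sparse_subset sB; apply: subsetDl.
Qed.

Lemma color_achieved B v c : flexible (1 / 4) B -> v \in B ->
  exists2 phi, legal B phi & phi v = c.
Proof.
move=> fB vB; have [phi pphi hphi] := fB (fun y d => if y == v then (d == c)%:R else 0).
exists phi => //; apply/eqP/negPn/negP => ne.
have single (F : V -> rat) : \sum_(y in B) (if y == v then F y else 0) = F v.
  by rewrite (bigD1 v) //= eqxx big1 ?addr0 // => y /andP[_ /negPf->].
rewrite single (negPf ne) in hphi.
have G y : guarantee (1 / 4) (fun d => if y == v then (d == c)%:R else 0) =
    if y == v then 1 / 4 else 0.
  case: eqP => _; last exact: guarantee_cst.
  by rewrite /guarantee /min3 /sum3; case: (c) => [[]|] /=; lra.
by rewrite (eq_bigr _ (fun y _ => G y)) single in hphi.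
Qed.

Lemma color_avoided B v c : flexible (1 / 4) B -> v \in B ->
  exists2 phi, legal B phi & phi v != c.
Proof.
move=> fB vB; have [x [_ [cx _ _ _]]] := two_others c (fun=> 0).
by have [phi pphi pv] := color_achieved x fB vB; exists phi; rewrite // pv eq_sym.
Qed.

Lemma joined_subset (P Q : pred V) x y : {subset P <= Q} -> joined P x y -> joined Q x y.
Proof. by move=> PQ [h [h1 h2 h3 h4 h5]]; exists h; split=> // z /h5/PQ. Qed.

(** Two ends outside the reducible forest are left to the induction. A single end outside is settled
    when the rest is colored, and an end with a lost color by coloring its outside neighbor so that
    the unwanted color is the lost one. There remain two ends in the forest without lost colors,
    where blocking produces the path. *)
Lemma two_ends B x y c c' : sparse 2 B -> x \in B -> y \in B -> x != y ->
  joined (mem B) x y \/ exists phi, [/\ legal B phi, phi x != c & phi y != c'].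
Proof.
have [n] := ubnP #|B|; elim: n B => // n IH B Bn sB xB yB xy.
have B0 : B != set0 by apply/set0Pn; exists x.
have [s red] := sparse2_reducible sB B0.
have [K hK] := reducible_kinds red.
have [_ us fs hs] := red.
have sR : sparse 2 (B :\: [set:: s]) by apply: sparse_subset sB; apply: subsetDl.
have fR := flexible_quarter sR.
have ss : {subset s <= s} by [].
have avoid psi v d : legal (B :\: [set:: s]) psi -> v \in s ->
    exists phi, [/\ legal B phi, phi v != d & {in B :\: [set:: s], phi =1 psi}].
  move=> ppsi vs.
  have [|phi [al ok w]] := sublist_coloring hK (psi := psi) (e := false) (c0 := d) us fs ss vs.
    by have [[_ _ /(_ d) h] _] := kind_law_law psi (K v); apply: (le_lt_trans h half_lt1).
  exists (glue s phi psi); split; first exact: legal_glue hK al ok ppsi.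
    by rewrite /glue vs; move: w; rewrite /want eqbF_neg.
  by move=> z; rewrite !inE /glue => /andP[/negPf->].
have [xs|xs] := boolP (x \in s); have [ys|ys] := boolP (y \in s).
- have [//|nophi] := classic (joined (mem B) x y \/
    exists phi, [/\ legal B phi, phi x != c & phi y != c']).
  have bl : blocked B s K s x false c y false c'.
    move=> psi phi ppsi al ok wx wy; apply: nophi; right; exists (glue s phi psi).
    split; first exact: legal_glue hK al ok ppsi.
      by rewrite /glue xs; move: wx; rewrite /want eqbF_neg.
    by rewrite /glue ys; move: wy; rewrite /want eqbF_neg.
  have all_colors o d : o \in B :\: [set:: s] ->
      exists2 psi, legal (B :\: [set:: s]) psi & psi o = d.
    exact: color_achieved.
  have some_legal : exists psi, legal (B :\: [set:: s]) psi.
    by have [psi ppsi _] := fR (fun _ _ => 0); exists psi.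
  have loss u v d d' : u \in s -> v \in s -> ~~ lossless (K u) ->
      exists phi, [/\ legal B phi, phi u != d & phi v != d'].
    move=> us' vs; move: (hK u us'); case EK: (K u) => [o k|||] //= [[oB os k_inj _ _] _] _.
    have [|psi ppsi psio] := all_colors o (invF k_inj d); first by rewrite !inE os.
    have [|phi [al ok w]] := sublist_coloring hK (psi := psi) (e := false) (c0 := d') us fs ss vs.
      by have [[_ _ /(_ d') h] _] := kind_law_law psi (K v); apply: (le_lt_trans h half_lt1).
    exists (glue s phi psi); split; first exact: legal_glue hK al ok ppsi.
      by rewrite /glue us'; have := al u us'; rewrite EK /= psio f_invF.
    by rewrite /glue vs; move: w; rewrite /want eqbF_neg.
  have [lx|nlx] := boolP (lossless (K x)); last by right; apply: loss.
  have [ly|nly] := boolP (lossless (K y)); last first.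
    by right; have [phi [h1 h2 h3]] := loss y x c' c ys xs nly; exists phi.
  left; apply: (@joined_subset (mem s)); first by move=> z /hs[].
  have ends v : lossless (K v) -> end_state K s v false [::] v by [].
  exact: (blocked_joined hK some_legal all_colors us fs ss xs ys xy bl (ends x lx) (ends y ly)).
- have [psi ppsi psiy] := color_avoided c' fR (v := y) ltac:(by rewrite !inE ys).
  have [phi [pphi px pE]] := avoid psi x c ppsi xs.
  by right; exists phi; split; rewrite // pE // !inE ys.
- have [psi ppsi psix] := color_avoided c fR (v := x) ltac:(by rewrite !inE xs).
  have [phi [pphi py pE]] := avoid psi y c' ppsi ys.
  by right; exists phi; split; rewrite // pE // !inE xs.
have [|||jn|[psi [ppsi px py]]] := IH (B :\: [set:: s]) _ sR _ _ xy.
- by apply: leq_trans (reducible_card red) _.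
- by rewrite !inE xs.
- by rewrite !inE ys.
- by left; apply: joined_subset jn => z; rewrite inE => /andP[].
right; have [phi [al ok _]] := reducible_coloring psi (fun _ _ => 0) red hK.
exists (glue s phi psi); split; first exact: legal_glue hK al ok ppsi.
  by rewrite /glue (negPf xs).
by rewrite /glue (negPf ys).
Qed.

(* The cycles of [I_m]: the walk [x :: h] alternates between double and simple
   edges, beginning and ending with a double one, and [w] closes it. *)
Definition no_alternating_cycle : Prop := forall w x h,
  alternating true x h -> odd (size h) -> uniq (w :: x :: h) ->
  nbr w x -> nbr w (last x h) -> False.

Hypothesis no_cycle : no_alternating_cycle.

Lemma ban_hit x y c : nbr x y -> exists d, ban x y c d.
Proof.
rewrite /nbr; have [ks <- banE] := ban_matchings x y; case: ks banE => // k ks banE _.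
by exists (k c); rewrite banE /= eqxx.
Qed.

Lemma okc_double x y c : mult x y = 2%N -> exists d, okc x y d c.
Proof.
rewrite mult_sym => /double_perfect_or_star[[k _ kE]|[t [t' ts]]].
  by exists (k c); rewrite okc_sym.
have [z [_ [tz _ _ _]]] := two_others t' (fun=> 0).
have [<-|ct] := eqVneq t c; [exists z | exists t']; rewrite okc_sym ts.
  by rewrite eqxx eq_sym (negPf tz).
by rewrite eqxx eq_sym (negPf ct).
Qed.

Lemma degree2_cases A w : w \in A -> dg A w = 2%N ->
  (exists2 u, u \in A :\ w & mult w u = 2%N /\
     {in A :\ w, forall y, nbr w y -> y = u}) \/
  exists u1 u2, [/\ u1 \in A :\ w, u2 \in A :\ w, u1 != u2,
    mult w u1 = 1%N /\ mult w u2 = 1%N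
    & {in A :\ w, forall y, nbr w y -> y = u1 \/ y = u2}].
Proof.
move=> wA; rewrite (dg_setID [set w]) (setIidPr _) ?sub1set //.
have -> : dg [set w] w = 0%N by rewrite /dg big_set1 mult_irrefl.
rewrite add0n => d2; set B := A :\ w in d2 *.
have [u1 u1B nu1] : exists2 u1, u1 \in B & nbr w u1.
  apply/exists_inP; apply: contra_eqT d2 => /exists_inPn none.
  by rewrite /dg big1 // => y /none; rewrite /nbr -eqn0Ngt => /eqP.
have [m2|m1] : mult w u1 = 2%N \/ mult w u1 = 1%N.
- move: d2 nu1; rewrite /dg (bigD1 u1) //= /nbr; lia.
- left; exists u1 => //; split=> // y yB ny; apply/eqP/negPn/negP => yu.
  move: d2; rewrite /dg (bigD1 u1) //= m2 (bigD1 y) ?yB //=; move: ny; rewrite /nbr; lia.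
have [u2 /andP[u2B u21] nu2] : exists2 u2, (u2 \in B) && (u2 != u1) & nbr w u2.
  apply/exists_inP; apply: contra_eqT d2 => /exists_inPn none.
  rewrite /dg (bigD1 u1) //= m1 big1 // => y yP; have := none y yP.
  by rewrite /nbr -eqn0Ngt => /eqP.
have sumE : (mult w u2 + \sum_(i in B | (i != u1) && (i != u2)) mult w i = 1)%N.
  move: d2; rewrite /dg (bigD1 u1) //= m1 (bigD1 u2) ?u2B //=.
  rewrite (eq_bigl (fun i => (i \in B) && ((i != u1) && (i != u2)))); first by lia.
  by move=> i; rewrite andbA.
have m2 : mult w u2 = 1%N by move: nu2 sumE; rewrite /nbr; lia.
right; exists u1, u2; split; rewrite // 1?eq_sym //.
move=> y yB ny; have [->|y1] := eqVneq y u1; first by left.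
right; apply/eqP/negPn/negP => y2; move: sumE; rewrite m2 (bigD1 y) ?yB ?y1 //=.
by move: ny; rewrite /nbr; lia.
Qed.

(** * Adding a vertex of degree 2 to a set flexible with 1/4 *)

Section DegreeTwo.

Variables (A : {set V}) (w : V).
Hypotheses (wA : w \in A) (dw : dg A w = 2%N) (sB : sparse 2 (A :\ w)).

Let B := A :\ w.

Lemma legal_upd phi c : legal B phi -> {in B, forall y, nbr w y -> okc w y c (phi y)} ->
  legal A (upd phi w c).
Proof.
move=> pphi ok.
have ok' y : y \in B -> okc w y c (phi y).
  by move=> yB; have [/ok->//|nv] := boolP (nbr w y); rewrite /okc ban_nbr.
have inB z : z \in A -> z != w -> z \in B by move=> zA zw; rewrite !inE zw.
move=> x y xA yA; rewrite /upd; have [->|xw] := eqVneq x w; have [->|yw] := eqVneq y w.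
- by rewrite /okc ban_nbr // /nbr mult_irrefl.
- by apply: ok'; apply: inB.
- by rewrite okc_sym; apply: ok'; apply: inB.
- by apply: pphi; apply: inB.
Qed.

(** The exclusion of alternating cycles enters here. A color of [w] bans one color at each of two
    distinct neighbors, and [two_ends] fails to avoid both only if an alternating path joins them,
    which [w] closes. *)
Lemma color_precolored c : exists2 phi, legal A phi & phi w = c.
Proof.
have [[u uB [m2 only]]|[u1 [u2 [u1B u2B u12 [m1 m2] only]]]] := degree2_cases wA dw.
  have [d okd] : exists d, okc w u c d.
    have [|d okd] := @okc_double u w c; first by rewrite mult_sym.
    by exists d; rewrite okc_sym.
  have [phi pphi pu] := color_achieved d (flexible_quarter sB) uB.
  exists (upd phi w c); last by rewrite /upd eqxx.
  by apply: legal_upd => // y yB /(only y yB)->; rewrite pu.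
have [k1 k1_inj k1E] := okc_single m1; have [k2 k2_inj k2E] := okc_single m2.
have [[h [alt_h odd_h last_h uh hB]]|[phi [pphi p1 p2]]] :=
    two_ends (k1 c) (k2 c) sB u1B u2B u12.
  case: (no_cycle (w := w) alt_h odd_h); rewrite ?last_h /nbr ?m1 ?m2 //.
  rewrite cons_uniq uh andbT; apply/negP => /hB; by rewrite !inE eqxx.
exists (upd phi w c); last by rewrite /upd eqxx.
by apply: legal_upd => // y yB /(only y yB)[]->; rewrite ?k1E ?k2E.
Qed.

Lemma room phi : exists c, {in B, forall y, nbr w y -> okc w y c (phi y)}.
Proof.
have [[u uB [m2 only]]|[u1 [u2 [u1B u2B u12 [m1 m2] only]]]] := degree2_cases wA dw.
  have [d okd] := okc_double (phi u) m2.
  by exists d => y yB /(only y yB)->.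
have [k1 k1_inj k1E] := okc_single (etrans (mult_sym u1 w) m1).
have [k2 k2_inj k2E] := okc_single (etrans (mult_sym u2 w) m2).
have [c /andP[c1 c2]] : exists c, (k1 (phi u1) != c) && (k2 (phi u2) != c).
  have [->|ne] := eqVneq (k1 (phi u1)) (k2 (phi u2)); last exact: third_color.
  have [x [_ [cx _ _ _]]] := two_others (k2 (phi u2)) (fun=> 0).
  by exists x; rewrite cx.
exists c => y yB /(only y yB)[]->; rewrite okc_sym ?k1E ?k2E eq_sym //.
Qed.

(* The best coloring of [A - w] loses nothing but the color of [w], and a
   neighbor of [w] excludes the worst color there with probability at least
   1/4; a coloring that is best at [w] makes up for the rest. *)
Lemma flexible_degree2 : flexible (1 / 5) A.
Proof.
move=> f; have [lo [mid [hi [xy yz xz fxy fyz]]]] := sort3 (f w).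
have [u uB nu] : exists2 u, u \in B & nbr w u.
  have [[u uB [m2 _]]|[u [_ [uB _ _ [m1 _] _]]]] := degree2_cases wA dw; exists u => //;
    by rewrite /nbr ?m1 ?m2.
have [d ban_lo] := ban_hit lo nu.
(* When [u] takes the color [d], the worst color [lo] is banned at [w], and the bonus is the
   improvement to at least [mid]. *)
pose bonus y c : rat := if y == u then (if c == d then f w mid - f w lo else 0) else 0.
have [phi pphi hphi] := flexible_quarter sB (fun y c => f y c + bonus y c).
have [c okw] := room phi; have [chi pchi chiw] := color_precolored hi.
have single (F : V -> rat) : \sum_(y in B) (if y == u then F y else 0) = F u.
  by rewrite (bigD1 u) //= eqxx big1 ?addr0 // => y /andP[_ /negPf->].
have splitw (F : V -> rat) : \sum_(y in A) F y = F w + \sum_(y in B) F y.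
  by rewrite (big_setD1 w wA).
pose V1 := f w c + \sum_(y in B) f y (phi y).
pose V2 := f w hi + \sum_(y in B) f y (chi y).
have fw : f w lo + (if phi u == d then f w mid - f w lo else 0) <= f w c.
  have [pd|_] := eqVneq (phi u) d; have := color_cases c xy yz xz.
    have cl : c != lo.
      by apply/eqP => cl; move: (okw u uB nu); rewrite /okc cl pd ban_lo.
    by rewrite (negPf cl) /= => /orP[]/eqP->; lra.
  by case/or3P=> /eqP->; lra.
have h1 : \sum_(y in B) guarantee (1 / 4) (f y) + 1 / 4 * (f w mid - f w lo) + f w lo <= V1.
  rewrite [leRHS]big_split /= single in hphi.
  have hb : 1 / 4 * (f w mid - f w lo) <= guarantee (1 / 4) (bonus u).
    have m0 : 0 <= min3 (bonus u).
      by rewrite /min3 !le_min /bonus eqxx; do 3! case: ifP => _; rewrite ?subr_ge0 ?fxy ?lexx.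
    rewrite /guarantee; have -> : sum3 (bonus u) = f w mid - f w lo.
      by rewrite /sum3 /bonus eqxx; case: (d) => [[]|] /=; rewrite ?addr0 ?add0r.
    have c0 : 0 <= 1 - 3 * (1 / 4) :> rat by rewrite subr_ge0; exact: quarter3_le1.
    rewrite lerDl; exact: mulr_ge0 c0 m0.
  have hs : \sum_(y in B) guarantee (1 / 4) (f y) + guarantee (1 / 4) (bonus u) <=
      \sum_(y in B) guarantee (1 / 4) (fun c => f y c + bonus y c).
    rewrite -(single (fun y => guarantee (1 / 4) (bonus y))) -big_split /=.
    apply: ler_sum => y _; have [->|yu] := eqVneq y u.
      exact: (guarantee_split quarter3_le1 (fun=> erefl)).
    rewrite addr0 (@guarantee_ext _ (f y) (fun c => f y c + bonus y c)); first exact: lexx.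
    by move=> e; rewrite /bonus (negPf yu) addr0.
  have H := le_trans (lerD (lexx _) hb) (le_trans hs hphi).
  rewrite -(lerD2r (if phi u == d then f w mid - f w lo else 0)) -[leLHS]addrA.
  by apply: le_trans (lerD H fw) _; rewrite /V1 [leLHS]addrC [leLHS]addrA lexx.
have h2 : \sum_(y in B) min3 (f y) + f w hi <= V2.
  by rewrite addrC lerD2l; apply: ler_sum => y _; apply: min3_le.
(* Away from [w], [phi] gives 4/5 of the guarantee with 1/4, and [chi] adds 1/5 of the minima:
   together the guarantee with 1/5. At [w] the sorted values get weights 3/5, 1/5, 1/5, again this
   guarantee. *)
have comb : \sum_(y in A) guarantee (1 / 5) (f y) <= 4 / 5 * V1 + 1 / 5 * V2.
  rewrite splitw; have -> : \sum_(y in B) guarantee (1 / 5) (f y) =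
      4 / 5 * \sum_(y in B) guarantee (1 / 4) (f y) + 1 / 5 * \sum_(y in B) min3 (f y).
    rewrite !mulr_sumr -big_split /=; apply: eq_bigr => y _.
    have arith (S M : rat) : 1 / 5 * S + (1 - 3 * (1 / 5)) * M =
        4 / 5 * (1 / 4 * S + (1 - 3 * (1 / 4)) * M) + 1 / 5 * M by lra.
    exact: arith.
  have -> : guarantee (1 / 5) (f w) = 3 / 5 * f w lo + 1 / 5 * f w mid + 1 / 5 * f w hi.
    rewrite /guarantee (sum3_distinct _ xy yz xz) (min3_sorted xy yz xz fxy fyz).
    have arith (l g h : rat) : 1 / 5 * (l + g + h) + (1 - 3 * (1 / 5)) * l =
        3 / 5 * l + 1 / 5 * g + 1 / 5 * h by lra.
    exact: arith.
  have arith (a b l g h X1 X2 : rat) : a + 1 / 4 * (g - l) + l <= X1 -> b + h <= X2 ->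
      3 / 5 * l + 1 / 5 * g + 1 / 5 * h + (4 / 5 * a + 1 / 5 * b) <= 4 / 5 * X1 + 1 / 5 * X2.
    by move=> *; lra.
  exact: arith h1 h2.
have arith (X Y : rat) : X <= Y -> 4 / 5 * X + 1 / 5 * Y <= Y /\ 4 / 5 * Y + 1 / 5 * X <= Y.
  by move=> *; split; lra.
have [le|/ltW lt] := leP V1 V2.
  exists chi => //; rewrite [leRHS]splitw chiw; apply: le_trans comb _.
  exact: (arith _ _ le).1.
exists (upd phi w c); first exact: legal_upd.
rewrite [leRHS]splitw; apply: le_trans comb _.
rewrite {1}/upd eqxx (eq_bigr (fun y => f y (phi y))); last first.
  by move=> y; rewrite /upd !inE => /andP[/negPf->].
exact: (arith _ _ lt).2.
Qed.

End DegreeTwo.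

(** * Proper subsets of surplus 1 and bridges *)

Section Tight.

Variables (A S : {set V}).
Hypotheses (irred : forall s, ~ reducible A s) (linkA : linked A).
Hypotheses (SA : S \subset A) (S0 : S != set0) (SnA : S != A).
Hypotheses (A1 : surplus A A = 1) (S1 : surplus S S = 1).

Let Z := A :\: S.

Lemma surplus_le1 D : D \subset A -> linked D -> surplus A D <= 1.
Proof.
move=> DA linkD; rewrite leNgt; apply/negP => D2.
have [u uD] := set0Pn _ (proj1 linkD).
have [||D1 _] := leg_exists irred DA (leqnn _) linkD _ (N := [set u]).
- exact: ltW.
- by exists u => //; rewrite inE.
by rewrite D1 in D2.
Qed.

Lemma edges_outside Y : Y \subset Z -> Y != set0 -> edges Y (Z :\: Y) = 0%N ->
  (0 < edges Y S)%N.
Proof.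
move=> YZ Y0 e0; have YA : Y \subset A := subset_trans YZ (subsetDl _ _).
have YnA : Y != A.
  apply: contraNneq S0 => YA'; apply/eqP/setP => x; rewrite inE; apply/negP => xS.
  by have := subsetP YZ x; rewrite YA' (subsetP SA) // !inE xS => /(_ isT).
have := proj2 linkA Y YA Y0 YnA; rewrite (edges_setIDr S) addn_gt0 => /orP[h|].
  by apply: leq_trans h _; apply: edges_subset => //; apply: subsetIr.
by rewrite setDDl setUC -setDDl e0.
Qed.

(** Each component of [Y] has surplus at most 1 and, as [A] is connected, at least one edge to
    [S]. *)
Lemma surplus_le_edges Y : Y \subset Z -> edges Y (Z :\: Y) = 0%N ->
  surplus A Y <= (edges Y S)%:Z.
Proof.
have [n] := ubnP #|Y|; elim: n Y => // n IH Y Yn YZ eY.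
have [->|Y0] := eqVneq Y set0; first by rewrite /surplus cards0 !edges0l.
have [D [DY De linkD]] := linked_component Y0.
have DZ := subset_trans DY YZ; have DA : D \subset A := subset_trans DZ (subsetDl _ _).
have eDZ : edges D (Z :\: D) = 0%N.
  apply/eqP; rewrite (edges_setIDr Y) -leqn0 -[0%N]addn0 leq_add //.
    rewrite -De edges_subset //; apply/subsetP => z; rewrite !inE.
    by case/andP => /andP[-> _] ->.
  rewrite -eY edges_subset //; apply/subsetP => z; rewrite !inE.
  by case/and3P => -> _ ->.
have eYD : edges (Y :\: D) (Z :\: (Y :\: D)) = 0%N.
  apply/eqP; rewrite (edges_setIDr Y) -leqn0 -[0%N]addn0 leq_add //.
    rewrite -De edges_sym edges_subset //; apply/subsetP => z; rewrite !inE.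
    by case: (z \in Y); rewrite ?andbF // !andbT negbK => /andP[].
  rewrite -eY edges_subset ?subsetDl //; apply/subsetP => z; rewrite !inE.
  by case/and3P => -> _ ->.
have gtD := edges_outside DZ (proj1 linkD) eDZ.
have leD := surplus_le1 DA linkD.
have DnY : (#|Y :\: D| < n)%N.
  have: (0 < #|D|)%N by rewrite card_gt0; case: linkD.
  by move: Yn; rewrite -(cardsID D Y) (setIidPr DY); clear; lia.
have leY := IH (Y :\: D) DnY (subset_trans (subsetDl _ _) YZ) eYD.
rewrite (surplus_setID A D Y) (edges_setIDl D Y) (setIidPr DY).
by move: gtD leD leY; clear; lia.
Qed.

(** Since [A] and [S] both have surplus 1, the complement of [S] attains equality in
    [surplus_le_edges]. Hence any of its components has surplus 1 and a single edge to [S]. *)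
Lemma bridge_component : exists D x p,
  [/\ D \subset Z, linked D, edges D (Z :\: D) = 0%N, surplus A D = 1
    & [/\ x \in S, p \in D, mult x p = 1%N &
        {in S & D, forall u v, nbr u v -> u = x /\ v = p}]].
Proof.
have Z0 : Z != set0.
  by rewrite setD_eq0; apply: contraNN SnA => AS; rewrite eqEsubset SA.
have [D [DZ De linkD]] := linked_component Z0.
have DA : D \subset A := subset_trans DZ (subsetDl _ _).
have gtD := edges_outside DZ (proj1 linkD) De.
have leD := surplus_le1 DA linkD.
have eZD : edges (Z :\: D) (Z :\: (Z :\: D)) = 0%N.
  by rewrite setDDr setDv set0U (setIidPr DZ) edges_sym.
have leZ := surplus_le_edges (subsetDl Z D) eZD.
have ZS : surplus A Z = (edges Z S)%:Z.
  have := surplus_setID A S A; rewrite A1 (setIidPr SA) -/Z.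
  have : surplus A S = surplus S S - (edges Z S)%:Z.
    by rewrite /surplus (edges_setIDr S A) (setIidPr SA) -/Z (edges_sym S Z); clear; lia.
  by rewrite S1; clear; lia.
move: ZS; rewrite (surplus_setID A D Z) (edges_setIDl D Z) (setIidPr DZ) => ZS.
have [D1 e1] : surplus A D = 1 /\ edges D S = 1%N.
  by move: gtD leD leZ ZS; clear; lia.
exists D; have [p [x [pD xS npx]]] := edges_gt0 gtD.
exists x, p; split=> //.
have eE : edges S D = (mult x p + dg (D :\ p) x + edges (S :\ x) D)%N.
  rewrite /edges (bigD1 x) //= (_ : dg D x = (mult x p + dg (D :\ p) x)%N).
    by congr (_ + _)%N; apply: eq_bigl => y; rewrite !inE andbC.
  rewrite {1}/dg (bigD1 p) //=; congr (_ + _)%N; apply: eq_bigl => y; by rewrite !inE andbC.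
have mxp : (0 < mult x p)%N by rewrite mult_sym.
have [m1 d0 e0] : [/\ mult x p = 1%N, dg (D :\ p) x = 0%N & edges (S :\ x) D = 0%N].
  by move: eE; rewrite edges_sym e1; move: mxp; clear => mxp eE; split; lia.
split=> // u v uS vD nuv; have [ux|ux] := eqVneq u x; last first.
  by have := edges_eq0 e0 (x := u) (y := v); rewrite !inE ux uS vD nuv => /(_ isT isT).
split=> //; apply/eqP/negPn/negP => vp; rewrite ux in nuv.
have : edges [set x] (D :\ p) = 0%N by rewrite edges1l.
by move/edges_eq0 => /(_ x v); rewrite !inE eqxx vp vD nuv => /(_ isT isT).
Qed.

End Tight.

Theorem flexible_fifth A : sparse 1 A -> flexible (1 / 5) A.
Proof.
have [n] := ubnP #|A|; elim: n A => // n IH A An sA.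
have [->|A0] := eqVneq A set0; first exact: flexible0.
have sub B : B \subset A -> B != A -> flexible (1 / 5) B.
  move=> BA BnA; apply: IH; last exact: sparse_subset sA.
  by rewrite -ltnS; apply: leq_trans An; rewrite ltnS proper_card // properEneq BnA.
have [[s red]|nored] := classic (exists s, reducible A s).
  apply: (flexible_reducible fifth_ge0 fifth_le_quarter red); apply: sub.
    exact: subsetDl.
  by apply/eqP => e; have := reducible_card red; rewrite e ltnn.
have irred s : ~ reducible A s by move=> red; apply: nored; exists s.
have [D [DA De linkD]] := linked_component A0.
have D0 := proj1 linkD.
have [DeqA|DnA] := eqVneq D A; last first.
  apply: (flexible_union DA De); first exact: sub.
  apply: sub; first exact: subsetDl.
  apply: contraNneq D0 => e; apply/eqP/setP => z; rewrite inE; apply/negP => zD.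
  by have := subsetP DA z zD; rewrite -e inE zD.
rewrite {D DA De D0}DeqA in linkD.
have A1 : surplus A A = 1.
  by apply/eqP; rewrite eq_le surplus_le1 ?sA.
pose P S := [&& S \subset A, S != set0, S != A & surplus S S == 1].
have [/existsP[T PT]|notight] := boolP [exists S, P S]; last first.
  (* A surplus of 1 puts the average degree below 3. *)
  have [w wA dw] : exists2 w, w \in A & (dg A w <= 2)%N.
    apply/exists_inP; apply: contraTT isT => /exists_inPn big; have := A1; rewrite /surplus.
    have : (3 * #|A| <= edges A A)%N.
      rewrite mulnC -sum_nat_const; apply: leq_sum => w wA.
      by have := big w wA; rewrite -ltnNge.
    by clear; lia.
  have s2 : sparse 2 (A :\ w).
    move=> Y YA Y0; have Y1 := sA Y (subset_trans YA (subsetDl _ _)) Y0.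
    have : surplus Y Y != 1.
      move: notight; rewrite negb_exists => /forallP/(_ Y); rewrite /P Y0.
      rewrite (subset_trans YA (subsetDl _ _)) /=; apply: contraNN => ->; rewrite andbT.
      by apply: contraTneq wA => <-; apply/negP => /(subsetP YA); rewrite !inE eqxx.
    by move: Y1; clear; lia.
  apply: (flexible_degree2 wA _ s2).
  have dE : dg A w = edges (A :\ w) [set w].
    rewrite edges_sym edges1l (dg_setID [set w]) (setIidPr _) ?sub1set //.
    by rewrite {1}/dg big_set1 mult_irrefl.
  (* The rest is empty or has surplus at least 2, and this identity then forces degree exactly 2. *)
  have surw : surplus A A = surplus (A :\ w) (A :\ w) + 3 - 2 * (dg A w)%:Z.
    rewrite /surplus (edges_setIDl [set w] A) (edges_setIDr [set w] A (_ :\ _)).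
    rewrite (setIidPr _) ?sub1set // edges1l -dE -(cardsID [set w] A) (setIidPr _) ?sub1set //.
    by rewrite cards1; clear; lia.
  have [Aw|Aw] := eqVneq (A :\ w) set0.
    by move: surw; rewrite A1 dE Aw /surplus cards0 !edges0l; clear; lia.
  by have := s2 _ (subxx _) Aw; move: surw dw; rewrite A1; clear; lia.
(* A largest set is chosen because the star case below tries to enlarge it by [p] and [b]. *)
case: (@arg_maxnP _ T P (fun S => #|S|) PT) => S /and4P[SA S0 SnA /eqP S1] Smax.
have [D [x [p [DZ linkD' De D1 [xS pD mxp bridge]]]]] :=
  bridge_component irred linkD SA S0 SnA A1 S1.
have DA : D \subset A := subset_trans DZ (subsetDl _ _).
have DnS z : z \in D -> z \notin S by move=> /(subsetP DZ); rewrite inE => /andP[].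
have DnA : D != A.
  have [z zS] := set0Pn _ S0; apply: contraTneq (zS) => e; apply: DnS.
  by rewrite e; apply: (subsetP SA).
have bridge' : {in A :\: D & D, forall u v, nbr u v -> u = x /\ v = p}.
  move=> u v; rewrite inE => /andP[uD uA] vD nuv; apply: bridge => //.
  apply: contraTT nuv => uS; rewrite nbr_sym (edges_eq0 De) // !inE uD uS //.
have xAD : x \in A :\: D.
  by rewrite inE (subsetP SA x xS) andbT; apply: contraTN xS; apply: DnS.
have dgA v : v \in D -> dg A v = (dg D v + (v == p))%N.
  move=> vD; rewrite (dg_setID D A) (setIidPr DA); congr (_ + _)%N.
  have off y : y \in A :\: D -> y != x -> mult v y = 0%N.
    move=> yA yx; apply/eqP; rewrite -leqn0 leqNgt; apply/negP => nvy.
    by have [e _] := bridge' y v yA vD (etrans (nbr_sym _ _) nvy); rewrite e eqxx in yx.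
  rewrite /dg (bigD1 x) //= big1 ?addn0; last by move=> y /andP[yA yx]; apply: off.
  have [->|vp] := eqVneq v p; first by rewrite mult_sym mxp.
  apply/eqP; rewrite -leqn0 leqNgt; apply/negP => nvx.
  by have [_ e] := bridge' x v xAD vD (etrans (nbr_sym _ _) nvx); rewrite e eqxx in vp.
have [||_ [s [q [us fs sD sN [/set1P qp dq]]]]] :=
  leg_exists irred DA (leqnn _) linkD' _ (N := [set p]).
- by rewrite D1.
- by exists p => //; rewrite inE.
rewrite {q}qp in us fs sD sN dq.
have pns : p \notin s by move: us; rewrite rcons_uniq => /andP[].
(* Inside [D] the bridge no longer counts, which lowers the degree of the root [p] by one and makes
   its leg reducible. *)
have red : reducible D (rcons s p).
  split=> //; first by case: (s).
  move=> v vs; split; first exact: sD.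
  move: vs; rewrite mem_rcons inE => /predU1P[->|vs].
    by move: dq; rewrite dgA // eqxx; clear; lia.
  have [_] := sN v vs; rewrite dgA; first by clear; lia.
  by apply: sD; rewrite mem_rcons inE vs orbT.
have [K hK] := reducible_kinds red.
have ps : p \in rcons s p by rewrite mem_rcons mem_head.
have fD : flexible (1 / 5) (A :\: D).
  apply: sub; first exact: subsetDl.
  apply: contraTneq pD => e; apply/negP => pD.
  by have := subsetP DA p pD; rewrite -e inE pD.
apply: (flexible_bridge DA xAD pD mxp bridge' fD).
have fDs : flexible (1 / 5) (D :\: [set:: rcons s p]).
  apply: sub; first exact: subset_trans (subsetDl _ _) DA.
  apply: contraTneq pD => e; apply/negP => pD.
  by have := subsetP DA p pD; rewrite -e !inE ps.
have [[b [c [c' EK]]]|nostar] := classic (exists b c c', K p = Star b c c'); last first.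
  apply: (evenly_flexible_reducible red hK ps _ fDs).
  by case EK: (K p) => [|b c c'||] //; case: nostar; exists b, c, c'.
have := hK p ps; rewrite EK => -[bs mpb st _ _].
have bD : b \in D := sD b bs.
have pb : p != b by apply/eqP => e; move: mpb; rewrite e mult_irrefl.
(* Adding [p] and [b] to [S] changes the surplus by [6 - 4 - 2 = 0], for two vertices, their double
   edge and the bridge. By maximality of [S] nothing else is left in [A]. *)
have -> : D = [set p; b]; last exact: evenly_flexible_star mpb st.
pose X := [set p; b].
have XD : X \subset D by apply/subsetP => z; rewrite !inE => /orP[]/eqP->.
have dS z : z \in D -> dg S z = (z == p).
  move=> zD; have := dgA z zD; rewrite (dg_setID D A) (setIidPr DA) => /addnI <-.
  rewrite (dg_setID S (A :\: D)).
  have -> : (A :\: D) :&: S = S.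
    apply/setIidPr/subsetP => y yS; rewrite inE (subsetP SA) // andbT.
    by apply: contraTN yS; apply: DnS.
  rewrite -[LHS]addn0; congr (_ + _)%N; apply/esym/eqP; rewrite -edges1l -leqn0 -De.
  apply: edges_subset; first by rewrite sub1set.
  by apply/subsetP => y; rewrite !inE => /and3P[-> -> ->].
have XE : edges X X = 4%N.
  by rewrite /edges /dg !(big_setU1, big_set1) ?inE //= !mult_irrefl (mult_sym b) mpb.
have XS : edges X S = 1%N.
  by rewrite /edges big_setU1 ?inE //= big_set1 !dS // eqxx (eq_sym b) (negPf pb).
have disj : S :&: X = set0.
  by apply/setP => z; rewrite inE in_set0; apply/negP => /andP[zS /(subsetP XD)/DnS]; rewrite zS.
have cardX : #|X| = 2%N by rewrite cards2 pb.
have SX1 : surplus (S :|: X) (S :|: X) = 1.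
  have I1 : (S :|: X) :&: X = X by apply/setIidPr/subsetUr.
  have I2 : (S :|: X) :\: X = S.
    by rewrite setDUl setDv setU0; apply/setDidPl; rewrite -setI_eq0 disj.
  have := S1; rewrite /surplus (edges_setIDl X (S :|: X)) I1 I2 !(edges_setIDr X (S :|: X)) I1 I2.
  rewrite XE XS (edges_sym S X) XS -(cardsID X (S :|: X)) I1 I2 cardX; clear; lia.
have SXA : S :|: X = A.
  apply/eqP/negPn/negP => ne; have /Smax : P (S :|: X).
    rewrite /P ne SX1 eqxx andbT; apply/and3P; split=> //.
      by rewrite subUset SA (subset_trans XD DA).
    by apply/set0Pn; exists p; rewrite !inE eqxx orbT.
  have := cardsUI S X; rewrite disj cards0 cardX; clear; lia.
apply/eqP; rewrite eqEsubset XD andbT; apply/subsetP => z zD.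
have := subsetP DA z zD; rewrite -SXA inE => /orP[zS|//].
by have := DnS z zD; rewrite zS.
Qed.

End Flexibility.

(** * From covers to networks *)

Section Multigraph.

Variable G : multigraph.
Implicit Types (x y : G) (Y : {set G}) (e : edge G).

Lemma multiplicity_sym x y : multiplicity x y = multiplicity y x.
Proof. by rewrite /multiplicity setUC. Qed.

Lemma multiplicity_irrefl x : multiplicity x x = 0%N.
Proof.
apply: eq_card0 => e; rewrite !inE; apply/negP => /eqP ee.
by have := ends_card e; rewrite ee setUid cards1.
Qed.

Lemma ends_neq e x y : ends e = [set x; y] -> x != y.
Proof. by move=> ee; have := ends_card e; rewrite ee cards2; case: eqP. Qed.

Lemma multiplicity_inside Y :
  (\sum_(x in Y) \sum_(y in Y) multiplicity x y <= 2 * #|[set e | ends e \subset Y]|)%N.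
Proof.
rewrite mulnC -sum_nat_const big_mkcond.
under eq_bigr => x _ do under eq_bigr => y _ do
  rewrite /multiplicity -sum1_card big_mkcond.
under eq_bigr => x _ do rewrite exchange_big.
rewrite -big_mkcond exchange_big [leqRHS]big_mkcond; apply: leq_sum => e _.
case: ifP; rewrite inE => eY; last first.
  rewrite big1 // => x xY; rewrite big1 // => y yY; rewrite inE; case: eqP => // ee.
  by rewrite ee subUset !sub1set xY yY in eY.
rewrite -(ends_card e) -sum1_card (big_setID (ends e)) (setIidPr eY) /=.
rewrite [X in (_ + X)%N]big1 ?addn0; last first.
  move=> x /setDP[_ xe]; rewrite big1 // => y _; rewrite inE; case: eqP => // ee.
  by rewrite ee !inE eqxx in xe.
apply: leq_sum => x xe; have [y ey] : exists y, ends e = [set x; y].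
  have /eqP := ends_card e; rewrite (cardsD1 x) xe eqSS => /cards1P[y ey].
  by exists y; rewrite -ey setD1K.
rewrite (bigD1 y) /=; last by apply: (subsetP eY); rewrite ey !inE eqxx orbT.
rewrite inE ey eqxx big1 // => z /andP[_ zy]; rewrite inE; case: eqP => // ee.
have := ends_neq ey; have: y \in [set x; z] by rewrite -ee ey !inE eqxx orbT.
by rewrite !inE (eq_sym y z) (negPf zy) orbF eq_sym => ->.
Qed.

Lemma mad_lt3_edges Y : mad G < 3 -> Y != set0 ->
  (2 * #|[set e | ends e \subset Y]| < 3 * #|Y|)%N.
Proof.
move=> mad3 Y0; set F := [set e | _].
have sub : is_subgraph Y F.
  by rewrite /is_subgraph Y0; apply/forall_inP => e; rewrite inE.
have : (2 * #|F|)%:R / #|Y|%:R < 3 :> rat.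
  apply: le_lt_trans mad3; rewrite /mad.
  exact: (@le_bigmax_cond _ _ _ _ (Y, F) (fun S => is_subgraph S.1 S.2)
    (fun S => (2 * #|S.2|)%:R / #|S.1|%:R) sub).
by rewrite ltr_pdivrMr ?ltr0n ?card_gt0 // -natrM ltr_nat.
Qed.

(** On a cycle of length at least 3, distinct consecutive pairs are distinct sets; only the added
    copies share their ends with another edge. *)
Lemma I_ends_source m (m_gt0 : (0 < m)%N) (e e' : 'I_(m.*2.+1) + 'I_m) :
  I_ends e = I_ends e' -> I_source e = I_source e'.
Proof.
rewrite /I_ends; move: (I_source e) (I_source e') => i j eij; apply/eqP/negPn/negP => ij.
have : i \in [set j; ordS j] by rewrite -eij !inE eqxx.
have : j \in [set i; ordS i] by rewrite eij !inE eqxx.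
rewrite !inE (eq_sym j i) (negPf ij) /= => /eqP/(congr1 val)/= jE /eqP/(congr1 val)/= iE.
have iL := ltn_ord i; have jL := ltn_ord j.
move: iE jE; have [iS|iS] := ltnP i.+1 m.*2.+1; have [jS|jS] := ltnP j.+1 m.*2.+1.
- by rewrite !modn_small //; clear; lia.
- have -> : j.+1 = m.*2.+1 by apply/eqP; rewrite eqn_leq jS jL.
  by rewrite modnn modn_small //; move: m_gt0 jS jL; clear; lia.
- have -> : i.+1 = m.*2.+1 by apply/eqP; rewrite eqn_leq iS iL.
  by rewrite modnn modn_small //; move: m_gt0 iS iL; clear; lia.
case/eqP: ij; apply: val_inj => /=; move: iS iL jS jL; clear; lia.
Qed.

Lemma I_subgraph m (m_gt0 : (0 < m)%N) (f : 'I_(m.*2.+1) -> G) : injective f ->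
  (forall i, 0 < multiplicity (f i) (f (ordS i)))%N ->
  (forall j : 'I_m, 1 < multiplicity (f (inord j.*2)) (f (ordS (inord j.*2))))%N ->
  has_subgraph_isomorphic_to G (I_multigraph m_gt0).
Proof.
move=> f_inj single double.
have /fin_all_exists[e1 e1E] i : exists e, ends e = [set f i; f (ordS i)].
  by have /card_gt0P[e] := single i; rewrite inE => /eqP; exists e.
have /fin_all_exists[e2 e2E] (j : 'I_m) : exists e,
    ends e = [set f (inord j.*2); f (ordS (inord j.*2))] /\ e != e1 (inord j.*2).
  have := double j; rewrite /multiplicity (cardsD1 (e1 (inord j.*2))) inE e1E eqxx.
  by case/card_gt0P => e; rewrite !inE => /andP[ne /eqP]; exists e.
pose g (e : 'I_(m.*2.+1) + 'I_m) := match e with inl i => e1 i | inr j => e2 j end.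
have gE u : ends (g u) = f @: I_ends u.
  by rewrite /I_ends imsetU1 imset_set1; case: u => [i|j] /=; [|have [-> _] := e2E j].
exists (f @: [set: 'I_(m.*2.+1)]), (g @: [set: _]); split.
  apply/andP; split; first by apply/set0Pn; exists (f ord0); apply: imset_f.
  apply/forall_inP => e /imsetP[e' _ ->]; rewrite gE; exact: imsetS (subsetT _).
exists f, g; split=> // e e' ee'.
have := congr1 (@ends G) ee'; rewrite !gE => /(imset_inj f_inj)/(I_ends_source m_gt0).
have dbl (j : 'I_m) : (j.*2 < m.*2.+1)%N by have := ltn_ord j; lia.
case: e e' ee' => [i|j] [i'|j'] //= ee'.
- by move->.
- by move=> ii; have [_] := e2E j'; rewrite -ii -ee' eqxx.
- by move=> ii; have [_] := e2E j; rewrite ii -ee' eqxx.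
move/(congr1 val); rewrite /= !inordK // => /double_inj jj.
by congr inr; apply: val_inj.
Qed.

End Multigraph.

Lemma partial_injection_perm (T : finType) (M : rel T) :
  (forall a b c d, M a b -> M c d -> a = c \/ b = d -> (a, b) = (c, d)) ->
  exists k : {perm T}, forall a b, M a b -> k a = b.
Proof.
move=> Minj; pose s := enum [pred p : T * T | M p.1 p.2].
suff [k ks] : exists k : {perm T}, {in s, forall p, k p.1 = p.2}.
  by exists k => a b ab; apply: (ks (a, b)); rewrite mem_enum.
have sM : {in s &, forall p q, p.1 = q.1 \/ p.2 = q.2 -> p = q}.
  by move=> [a b] [c d]; rewrite !mem_enum; apply: Minj.
have : uniq s by apply: enum_uniq.
elim: s sM => [|[a b] s IH] sM /=; first by exists 1%g.
case/andP => abs us; have [|k ks] := IH _ us.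
  by move=> p q ps qs; apply: sM; rewrite inE ?ps ?qs orbT.
(* The transposition corrects the value at [a] and keeps the earlier ones, none of which is [k a] or
   [b]. *)
exists (k * tperm (k a) b)%g => p; rewrite inE permM => /predU1P[->|ps] /=.
  exact: tpermL.
have pab : p != (a, b) by apply: contraNneq abs => <-.
have sp : p \in (a, b) :: s by rewrite inE ps orbT.
rewrite ks // tpermD //.
  rewrite -(ks p ps) (inj_eq perm_inj); apply: contraNneq pab => e; apply/eqP.
  by apply: sM; rewrite ?mem_head //; left.
by apply: contraNneq pab => e; apply/eqP; apply: sM; rewrite ?mem_head //; right.
Qed.

Lemma card_color : #|{: color}| = 3%N.
Proof. by rewrite card_option card_bool. Qed.

Lemma color_enumeration (W : finType) (X : {set W}) : #|X| = 3%N ->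
  exists p : color -> W, injective p /\ p @: [set: color] = X.
Proof.
move=> X3; have eX : #|{: color}| = #|X| by rewrite card_color X3.
pose p c := enum_val (cast_ord eX (enum_rank c)); exists p.
have p_inj : injective p by move=> c d /enum_val_inj/cast_ord_inj/enum_rank_inj.
split=> //; apply/eqP; rewrite eqEcard card_imset // cardsT eX leqnn andbT.
by apply/subsetP => _ /imsetP[c _ ->]; apply: enum_valP.
Qed.

Lemma alternating_nth (V : network) (d : bool) (x0 x : V) h i :
  alternating d x h -> (i < size h)%N ->
  (d (+) odd i < mult (nth x0 (x :: h) i) (nth x0 (x :: h) i.+1))%N.
Proof.
elim: h d x i => //= y h IH d x [|i] /andP[dxy alt_h]; first by rewrite addbF.
by rewrite ltnS => /(IH _ _ _ alt_h); rewrite addNb -addbN.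
Qed.

Lemma sum3_ge0 (f : color -> rat) : (forall c, 0 <= f c) -> 0 <= sum3 f.
Proof. by move=> f0; rewrite /sum3 !addr_ge0. Qed.

Lemma le_sum3 (f : color -> rat) c : (forall c, 0 <= f c) -> f c <= sum3 f.
Proof.
move=> f0; move: (f0 None) (f0 (Some false)) (f0 (Some true)); rewrite /sum3.
by case: c => [[]|]; clear; lra.
Qed.

Lemma guarantee_ge_sum3 (a : rat) (f : color -> rat) :
  3 * a <= 1 -> (forall c, 0 <= f c) -> a * sum3 f <= guarantee a f.
Proof.
move=> a3 f0; rewrite lerDl mulr_ge0 ?subr_ge0 //.
by rewrite /min3 !le_min !f0.
Qed.

Section Cover.

Variables (G : multigraph) (H : sgraph) (L : G -> {set H}).
Hypothesis coverL : is_cover 3 L.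

Lemma cover_perms (p : G -> color -> H) :
  (forall v, injective (p v) /\ p v @: [set: color] = L v) ->
  forall x y, x != y -> exists2 ks : seq {perm color}, size ks = multiplicity x y &
    forall c c', adj (p x c) (p y c') -> has (fun k : {perm color} => k c == c') ks.
Proof.
move=> pP x y xy; have [_ _ _ _ /(_ x y xy)[Ms [Mcard Mmatch Mcover]]] := coverL.
have pL v c : p v c \in L v by rewrite -(proj2 (pP v)) imset_f.
have /fin_all_exists[k kP] (M : {set H * H}) : exists k : {perm color}, M \in Ms ->
    forall c c', (p x c, p y c') \in M -> k c = c'.
  have [MMs|] := boolP (M \in Ms); last by exists 1%g.
  have [_ inj] := Mmatch M MMs; pose R c c' := (p x c, p y c') \in M.
  have [|k kM] := @partial_injection_perm _ R; last by exists k => _.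
  move=> a b c d ab cd e.
  have [/(proj1 (pP x))-> /(proj1 (pP y))-> //] : (p x a, p y b) = (p x c, p y d).
  by apply: inj => //=; case: e => ->; auto.
(* Missing matchings are filled up with identities: additional bans only make the coloring
   harder. *)
exists (map k (enum Ms) ++ nseq (multiplicity x y - #|Ms|) 1%g).
  by rewrite size_cat size_map size_nseq -cardE subnKC.
move=> c c' ac; rewrite has_cat; apply/orP; left.
have : (p x c, p y c') \in finset.cover Ms by rewrite -Mcover !inE !pL.
case/bigcupP => M MMs cM; apply/hasP; exists (k M); first by rewrite map_f ?mem_enum.
by rewrite (kP M MMs _ _ cM).
Qed.

Lemma cover_network : exists (p : G -> color -> H)
    (b : G -> G -> color -> color -> bool),
  [/\ forall v, injective (p v) /\ p v @: [set: color] = L v,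
      forall x y c c', b x y c c' = b y x c' c,
      forall x y, exists2 ks : seq {perm color}, size ks = multiplicity x y &
        forall c c', b x y c c' = has (fun k : {perm color} => k c == c') ks
    & forall x y c c', x != y -> adj (p x c) (p y c') -> b x y c c'].
Proof.
have [_ _ L3 _ _] := coverL.
have /fin_all_exists[p pP] v := color_enumeration (L3 v).
have kP (q : G * G) : exists ks : seq {perm color}, q.1 != q.2 ->
    size ks = multiplicity q.1 q.2 /\ forall c c', adj (p q.1 c) (p q.2 c') ->
      has (fun k : {perm color} => k c == c') ks.
  have [e|ne] := eqVneq q.1 q.2; first by exists [::].
  by have [ks sz kP] := cover_perms pP ne; exists ks.
have {kP} [K kP] := fin_all_exists kP.
pose hit x y c c' := has (fun k : {perm color} => k c == c') (K (x, y)).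
(* Permutations are used for one order of each pair, fixed by [enum_rank], and inverted for the
   other, which makes [b] symmetric. *)
pose b x y c c' := (x != y) &&
  (if (enum_rank x < enum_rank y)%N then hit x y c c' else hit y x c' c).
exists p, b; split=> //.
- move=> x y c c'; rewrite /b eq_sym; case: eqVneq => //= xy.
  case: ltngtP => // /val_inj/enum_rank_inj e; by rewrite e eqxx in xy.
- move=> x y; have [<-|xy] := eqVneq x y.
    by exists [::]; [rewrite multiplicity_irrefl | move=> c c'; rewrite /b eqxx].
  case: (boolP (enum_rank x < enum_rank y)%N) => lt; rewrite /b xy /= ?(negPf lt) ?lt.
    by exists (K (x, y)); [case: (kP (x, y) xy) |].
  rewrite eq_sym in xy.
  exists (map (fun k : {perm color} => k^-1)%g (K (y, x))).
    by rewrite size_map multiplicity_sym; case: (kP (y, x) xy).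
  move=> c c'; rewrite has_map; apply: eq_has => k /=.
  by rewrite (can2_eq (permK k) (permKV k)) eq_sym.
move=> x y c c' xy ac; rewrite /b xy /=; case: ifP => _.
  by have [_] := kP (x, y) xy; apply.
by rewrite eq_sym in xy; have [_] := kP (y, x) xy; apply; rewrite adj_sym.
Qed.

End Cover.

Theorem no_I_flexible (G : multigraph) : mad G < 3 ->
  (forall m (m_gt0 : (0 < m)%N), ~ has_subgraph_isomorphic_to G (I_multigraph m_gt0)) ->
  flexibly_DP_colorable (1 / 5) 3 G.
Proof.
move=> mad3 noI H L coverL U r [U0 rU].
have [p [b [pP b_sym b_match b_adj]]] := cover_network coverL.
pose V := @Network G _ b (@multiplicity_sym G) (@multiplicity_irrefl G) b_sym b_match.
have no_cycle : no_alternating_cycle V.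
  move=> w x h alt_h odd_h us nwx nwl.
  pose m := uphalf (size h).
  have sz : (size h).+1 = m.*2 by rewrite /m uphalfE -[LHS]odd_double_half /= odd_h.
  have sz' : size (x :: h) = m.*2 := sz.
  have m_gt0 : (0 < m)%N by rewrite -double_gt0 -sz.
  apply: (noI m m_gt0).
  (* The list [x :: h] has length [m.*2], so the last index falls on the default value [w], which
     closes the cycle. *)
  pose f (i : 'I_(m.*2.+1)) : G := nth w (x :: h) i.
  have fE i : f i = nth w (rcons (x :: h) w) i.
    rewrite /f nth_rcons; case: ltnP => // ge; rewrite nth_default //.
    by case: eqP.
  have ur : uniq (rcons (x :: h) w) by rewrite rcons_uniq -cons_uniq.
  have f_inj : injective f.
    move=> i j; rewrite !fE => /eqP; rewrite nth_uniq ?size_rcons ?sz' ?ltn_ord //.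
    by move/eqP/val_inj.
  have last_step : nth w (x :: h) (size h) = last x h.
    exact: (nth_last w (x :: h)).
  have step (i : 'I_(m.*2.+1)) :
      (~~ odd i && (i < m.*2) < multiplicity (f i) (f (ordS i)))%N.
    rewrite /f /=; have [lt|ge] := ltnP i m.*2.
      rewrite modn_small // andbT; have [lt'|ge'] := ltnP i (size h).
        by have := alternating_nth w alt_h lt'; rewrite addTb.
      have -> : val i = size h.
        by apply/eqP; rewrite eqn_leq ge' andbT -ltnS sz.
      by rewrite last_step odd_h sz nth_default ?sz' // multiplicity_sym; exact: nwl.
    have -> : val i = m.*2 by apply/eqP; rewrite eqn_leq ge andbT -ltnS ltn_ord.
    by rewrite modnn nth_default ?sz' // andbF; exact: nwx.
  apply: (I_subgraph m_gt0 f_inj) => [i|j]; first by apply: leq_ltn_trans (step i).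
  have := step (inord j.*2); rewrite inordK; last by have := ltn_ord j; lia.
  by rewrite odd_double ltn_double ltn_ord.
have sp : sparse 1 [set: V].
  move=> Y _ Y0; have lt := mad_lt3_edges mad3 Y0.
  have := multiplicity_inside Y; rewrite /surplus => le.
  have : (edges Y Y < 3 * #|Y|)%N by apply: leq_ltn_trans lt.
  by clear; lia.
have col v c : p v c \in L v by rewrite -(proj2 (pP v)) imset_f.
(* This weight counts granted requests, and its guarantee is at least 1/5 at each vertex of [U]. *)
pose f (v : V) c : rat := ((v \in U) && (p v c == r v))%:R.
have [phi legal_phi le_phi] := flexible_fifth no_cycle sp f.
exists (fun v => p v (phi v)); split.
  split=> // e x y /ends_neq xy.
  by apply: contraNN (legal_phi x y (in_setT x) (in_setT y)); apply: b_adj.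
have -> : #|[set v in U | p v (phi v) == r v]|%:R = \sum_(v in [set: V]) f v (phi v).
  rewrite -sum1_card natr_sum big_mkcond; apply: eq_big => v; rewrite !inE // => _.
  by rewrite /f; case: ifP.
apply: le_trans le_phi; rewrite -sum1_card natr_sum mulr_sumr [leLHS]big_mkcond.
rewrite [leRHS]big_mkcond; apply: ler_sum => v _; rewrite in_setT.
apply: le_trans (guarantee_ge_sum3 _ _); last 2 first.
- by move: fifth3_le1.
- by move=> c; rewrite /f ler0n.
have [vU|_] := ifP; last by rewrite mulr_ge0 ?divr_ge0 ?sum3_ge0 // => c; rewrite /f ler0n.
rewrite ler_wpM2l ?divr_ge0 //.
have : r v \in p v @: [set: color] by rewrite (proj2 (pP v)) rU.
case/imsetP => c _ rE; apply: le_trans (le_sum3 c _); first by rewrite /f vU rE eqxx.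
by move=> d; rewrite /f ler0n.
Qed.

(** * A cover of I_m that refuses a request *)

Section Obstruction.

Variables (G : multigraph) (m : nat) (m_gt0 : (0 < m)%N).
Variables (f : 'I_(m.*2.+1) -> G) (g : 'I_(m.*2.+1) + 'I_m -> edge G).
Hypotheses (f_inj : injective f) (g_inj : injective g).
Hypothesis gE : forall u, ends (g u) = f @: I_ends u.

Definition doubled (i : 'I_(m.*2.+1)) : bool := ~~ odd i && (i < m.*2)%N.

(* Doubled edges forbid the four pairs of colors [Some _], the single edges of
   the cycle forbid the pair [None], [None]. *)
Definition clash (x y : G) (c c' : color) : bool :=
  [exists u, (ends (g u) == [set x; y]) &&
     ((isSome c == doubled (I_source u)) && (isSome c' == doubled (I_source u)))].

Definition clash_adj (p q : G * color) : bool :=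
  if p.1 == q.1 then p.2 != q.2 else clash p.1 q.1 p.2 q.2.

Lemma clash_adj_sym : symmetric clash_adj.
Proof.
move=> [x c] [y c']; rewrite /clash_adj /= eq_sym; case: ifP => _; first by rewrite eq_sym.
by apply: eq_existsb => u; rewrite setUC [X in _ && X]andbC.
Qed.

Lemma clash_adj_irrefl : irreflexive clash_adj.
Proof. by move=> p; rewrite /clash_adj !eqxx. Qed.

Definition clash_graph := SGraph clash_adj_sym clash_adj_irrefl.

Definition clash_list (v : G) : {set clash_graph} := [set p | p.1 == v].

Lemma same_ends u u' : ends (g u) = ends (g u') -> I_source u = I_source u'.
Proof. by rewrite !gE => /(imset_inj f_inj)/(I_ends_source m_gt0). Qed.

(** For the two values of [t] these matchings partition the four pairs of colors that a doubled edge
    forbids. *)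
Definition crossing (x y : G) (t : bool) : {set clash_graph * clash_graph} :=
  [set ((x, Some b), (y, Some (b (+) t))) | b in [set: bool]].

Lemma matching_crossing x y t : matching_between (clash_list x) (clash_list y) (crossing x y t).
Proof.
split; first by apply/subsetP => _ /imsetP[b _ ->]; rewrite !inE !eqxx.
move=> _ _ /imsetP[b _ ->] /imsetP[b' _ ->] /= [[->]//|[] /(can_inj (addbK t)) -> //].
Qed.

Lemma clash_is_cover : is_cover 3 clash_list.
Proof.
split.
- move=> x y xy; rewrite -setI_eq0; apply/eqP/setP => p; rewrite !inE.
  by apply/negP => /andP[/eqP px /eqP py]; rewrite -px py eqxx in xy.
- by apply/setP => p; rewrite inE; apply/bigcupP; exists p.1; rewrite ?inE.
- move=> v; have inj : injective (pair v : color -> clash_graph) by move=> c d [].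
  rewrite -card_color -cardsT -(card_imset _ inj); apply: eq_card.
  move=> [x c]; rewrite inE; apply/eqP/imsetP => /= [->|[c' _ [->]]//].
  by exists c.
- move=> v [x c] [y c']; rewrite !inE => /= /eqP-> /eqP->.
  by rewrite /clash_adj /= eqxx; apply: contraNneq => ->.
move=> x y xy; have inE' p q : (p, q) \in edges_between (clash_list x) (clash_list y) =
    [&& p.1 == x, q.1 == y & clash x y p.2 q.2].
  rewrite !inE /= /clash_adj -andbA; case: eqP => //= ->; case: eqP => //= ->.
  by rewrite (negPf xy).
have [u /eqP eu|none] := pickP (fun u => ends (g u) == [set x; y]); last first.
  exists set0; split; [by rewrite cards0 | by move=> M; rewrite inE |].
  apply/setP => -[p q]; rewrite inE' /finset.cover big_set0 inE.
  by apply/negP => /and3P[_ _ /existsP[u]]; rewrite none.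
have clashE c c' : clash x y c c' =
    (isSome c == doubled (I_source u)) && (isSome c' == doubled (I_source u)).
  apply/existsP/idP => [[u' /andP[/eqP eu']]|h]; last by exists u; rewrite eu eqxx.
  by rewrite (@same_ends u' u) // eu.
have [dbl|single] := boolP (doubled (I_source u)).
  exists [set crossing x y true; crossing x y false]; split.
  - apply: leq_trans (_ : 2 <= _)%N; first by rewrite cards2; case: eqP.
    have [j jE] : exists j : 'I_m, inord j.*2 = I_source u.
      case/andP: dbl => ev lt; have ltj : ((I_source u)./2 < m)%N by rewrite ltn_half_double.
      by exists (Ordinal ltj); apply: val_inj; rewrite /= even_halfK // inordK.
    have sub : g @: [set inl (I_source u); inr j] \subset [set e | ends e == [set x; y]].
      apply/subsetP => _ /imsetP[u' u'E ->]; rewrite inE -eu !gE /I_ends.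
      by move: u'E; rewrite !inE => /orP[]/eqP-> /=; rewrite ?jE.
    by apply: leq_trans (subset_leq_card sub); rewrite card_imset // cards2.
  - by move=> M; rewrite !inE => /orP[]/eqP->; apply: matching_crossing.
  apply/setP => -[[x' c] [y' c']]; rewrite inE' clashE dbl /finset.cover.
  rewrite bigcup_setU !big_set1 inE /=; apply/and3P/orP.
    case=> /eqP-> /eqP->; case: c c' => [b|] [b'|] //= _.
    case bb: (b (+) b'); [left|right]; apply/imsetP; exists b => //.
      by move: bb; case: b b' => [] [].
    by move: bb; case: b b' => [] [].
  by case=> /imsetP[b _ [-> -> -> ->]]; rewrite !eqxx.
exists [set [set ((x, None), (y, None))]]; split.
- by rewrite cards1 card_gt0; apply/set0Pn; exists (g u); rewrite inE eu.
- move=> M; rewrite inE => /eqP->; split; first by rewrite sub1set !inE !eqxx.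
  by move=> p q /set1P-> /set1P->.
apply/setP => -[[x' c] [y' c']]; rewrite inE' clashE (negPf single) /finset.cover.
rewrite big_set1 inE !xpair_eqE /=.
by case: c c' => [b|] [b'|]; rewrite ?andbF ?andbT.
Qed.

Lemma obstruction : ~ flexibly_DP_colorable (1 / 5) 3 G.
Proof.
move=> /(_ clash_graph clash_list clash_is_cover [set f ord_max] (fun v => (v, None))).
case=> [|phi [[phiL phi_ok] le_phi]].
  by split=> [|v _]; [apply/set0Pn; exists (f ord_max); rewrite inE | rewrite inE].
(* For a request at a single vertex, a fifth of it is already all of it. *)
have phi_max : phi (f ord_max) = (f ord_max, None).
  apply/eqP; apply: contraTT le_phi => ne; rewrite -ltNge cards1.
  rewrite (_ : [set v in _ | _] = set0) ?cards0 //.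
  by apply/setP => v; rewrite !inE; case: eqP => //= ->; apply/negbTE.
pose c (n : nat) : bool := isSome (phi (f (inord n))).2.
have step (i : 'I_(m.*2.+1)) : ~~ ((c i == doubled i) && (c (ordS i) == doubled i)).
  have eE : ends (g (inl i)) = [set f i; f (ordS i)] by rewrite gE /I_ends imsetU1 imset_set1.
  apply: contraTN (phi_ok _ _ _ eE) => ci; rewrite negbK.
  have phi1 v : (phi v).1 = v by have := phiL v; rewrite inE => /eqP.
  rewrite /adj /= /clash_adj !phi1 (negPf (ends_neq eE)); apply/existsP; exists (inl i).
  by rewrite eE eqxx /=; move: ci; rewrite /c !inord_val.
have c_max : c m.*2 = false.
  by rewrite /c (_ : inord _ = ord_max) ?phi_max //; apply: val_inj; rewrite /= inordK.
(* From [None] at the last vertex, the single edge closing the cycle forces [Some _] at the first,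
   and the colors then alternate. After an even number of further steps the last vertex would have
   [Some _]. *)
have cE n : (n <= m.*2)%N -> c n = ~~ odd n.
  elim: n => [|n IH] le_n.
    have := step ord_max; rewrite /doubled /= ltnn andbF c_max modnn.
    by case: (c 0%N).
  have := step (inord n); rewrite /doubled /= inordK; last by rewrite ltnS ltnW.
  by rewrite le_n andbT (IH (ltnW le_n)) eqxx modn_small //= => /negPf; case: (c _); case: odd.
by have := cE _ (leqnn _); rewrite c_max odd_double.
Qed.

End Obstruction.

Theorem theorem1p5 (G : multigraph) (mad_lt3 : mad G < 3) :
  flexibly_DP_colorable (1 / 5) 3 G <->
  (forall (m : nat) (m_gt0 : (0 < m)%N),
     ~ has_subgraph_isomorphic_to G (I_multigraph m_gt0)).
Proof.
split=> [flex m m_gt0 [A [F [_ [f [g [f_inj g_inj _ _ gE]]]]]]|]; last exact: no_I_flexible.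
exact: obstruction f_inj g_inj gE flex.
Qed.
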